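(* Let $\{B_0,B_1\}$ be a stable set of real square matrices of the same size. Consider the problem of finding column vectors $\mathbf{b}_0,\mathbf{b}_1$ and a final distribution $F$ such that, for any choice of the initial distribution $I$, the transition matrices $$A_i=\begin{pmatrix} B_i & \mathbf{b}_i\\ \mathbf{0} & 1\end{pmatrix},\quad i=0,1,$$ together with $I$ and $F$ describe an average preserving WFA $\mathcal{A}$ over $\{0,1\}$ such that $f_{\mathcal{A}}$ is continuous on $\{0,1\}^\omega$ and $\hat f_{\mathcal{A}}$ is continuous on $[0,1)$, and such that in addition $A_0F\neq F$. Let $E$ be the identity matrix. (1) If $\det(B_0+B_1-E)=0$, then such vectors $\mathbf{b}_0,\mathbf{b}_1$ and $F$ can be found algorithmically. (2) If $\det(B_0+B_1-E)\neq0$, then such choices do not exist: only constant functions $f_{\mathcal{A}}$ can be obtained, i.e. whenever $\mathbf{b}_0,\mathbf{b}_1,F$ satisfy all the requirements other than $A_0F\ne F$, the function $f_{\mathcal{A}}$ is constant for every $I$.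
   Context: Words are over $\Sigma=\{0,1\}$: $\Sigma^*$ is the set of finite words, $\Sigma^\omega$ the set of infinite words with metric $d_C(w,w')=2^{-k}$, $k$ the length of the longest common prefix of $w\neq w'$; $\mathrm{pref}_k(w)$ is the length-$k$ prefix of $w$. For matrices $A_0,A_1$ and $v=v_1\cdots v_k$, $A_v=A_{v_1}\cdots A_{v_k}$. A set $\{B_0,B_1\}$ is stable if $\lim_{k\to\infty}B_{\mathrm{pref}_k(w)}=0$ for every $w\in\Sigma^\omega$. A WFA $\mathcal{A}$ over $\Sigma$ with $n$ states consists of an initial distribution $I\in\mathbb{R}^{1\times n}$, a final distribution $F\in\mathbb{R}^{n\times1}$ and transition matrices $A_0,A_1\in\mathbb{R}^{n\times n}$; its $\omega$-function is $f_{\mathcal{A}}(w)=\lim_{k\to\infty}IA_{\mathrm{pref}_k(w)}F$, undefined where the limit does not exist. It is average preserving if $A_0F+A_1F=2F$. For $w\in\Sigma^\omega$ put $num(w)=\sum_{i\ge1}w_i2^{-i}$, and let $\Omega=\Sigma^\omega\setminus\Sigma^*1^\omega$. Then $num|_\Omega:\Omega\to[0,1)$ is a bijection with inverse $bin$, and $\hat f_{\mathcal{A}}(x)=f_{\mathcal{A}}(bin(x))$ for $x\in[0,1)$. All matrix entries are assumed given so that exact addition, multiplication, division and equality testing are algorithmic (for example, rational entries). *)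

(* Defs.v *)
From HB Require Import structures.
From mathcomp Require Import all_boot all_order all_algebra.
From mathcomp Require Import all_classical all_reals all_analysis.

Set Implicit Arguments.
Unset Strict Implicit.
Unset Printing Implicit Defensive.

Import Order.TTheory GRing.Theory Num.Theory.
Import numFieldNormedType.Exports.

Local Open Scope classical_set_scope.
Local Open Scope ring_scope.

(* Words over {0,1}: a letter is a bool (false = 0, true = 1), a finite word a
   sequence of letters.  Infinite words are indexed from 0, so that the (i+1)-st
   letter of [w] is [w i]. *)

Definition iword := nat -> bool.

Definition pref (k : nat) (w : iword) : seq bool := mkseq w k.

(* The first index at which two distinct words differ is the length of their
   longest common prefix. *)
Definition dC (R : realType) (w w' : iword) : R :=
  if pselect (exists k, w k != w' k) is left h then 2 ^- ex_minn h else 0.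

Definition continuous_dC (R : realType) (f : iword -> R) : Prop :=
  forall (w : iword) (e : R), 0 < e ->
    exists2 d : R, 0 < d & forall w', dC R w w' < d -> `|f w - f w'| < e.

Definition mxword (R : realType) (n : nat) (A : bool -> 'M[R]_n)
    (v : seq bool) : 'M[R]_n :=
  \big[mulmx/1%:M]_(a <- v) A a.

Definition letters (T : Type) (x0 x1 : T) (a : bool) : T := if a then x1 else x0.

Definition stable (R : realType) (n : nat) (B0 B1 : 'M[R]_n) : Prop :=
  forall w : iword,
    (fun k => mxword (letters B0 B1) (pref k w)) @ \oo --> (0 : 'M[R]_n).

Record wfa (R : realType) (n : nat) := WFA {
  init : 'rV[R]_n;
  trans : bool -> 'M[R]_n;
  final : 'cV[R]_n }.

Section Wfa.
Variables (R : realType) (n : nat) (A : wfa R n).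

Definition average_preserving : Prop :=
  trans A false *m final A + trans A true *m final A = 2 *: final A.

Definition omega_seq (w : iword) (k : nat) : R :=
  (init A *m mxword (trans A) (pref k w) *m final A) 0 0.

(* The omega-function is partial: [omega_fun w] is meaningful only when
   [omega_defined w] holds. *)
Definition omega_defined (w : iword) : Prop := cvgn (omega_seq w).
Definition omega_fun (w : iword) : R := limn (omega_seq w).

Definition omega_continuous : Prop :=
  (forall w, omega_defined w) /\ continuous_dC omega_fun.

Definition omega_constant : Prop :=
  exists c : R, forall w, omega_seq w @ \oo --> c.

End Wfa.

Definition num_word (R : realType) (w : iword) : R :=
  limn (series (fun i => (w i)%:R * 2 ^- i.+1 : R)).

Definition Omega : set iword :=
  [set w | ~ exists k, forall i, (k <= i)%N -> w i = true].

(* The inverse of the bijection [num_word : Omega -> [0, 1[ ]; the default word is only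
   used outside [0, 1[. *)
Definition bin_word (R : realType) (x : R) : iword :=
  xget (fun=> false) [set w | Omega w /\ num_word R w = x].

Definition hat_fun (R : realType) (n : nat) (A : wfa R n) (x : R) : R :=
  omega_fun A (bin_word x).

Definition hat_continuous (R : realType) (n : nat) (A : wfa R n) : Prop :=
  (forall x : R, 0 <= x < 1 -> omega_defined A (bin_word x)) /\
  {within `[0, 1[, continuous (hat_fun A)}.

Definition ext_mx (R : realType) (n : nat) (B : 'M[R]_n) (b : 'cV[R]_n) :
    'M[R]_(n + 1) :=
  block_mx B b 0 1%:M.

Definition ext_wfa (R : realType) (n : nat) (B0 B1 : 'M[R]_n)
    (b0 b1 : 'cV[R]_n) (F : 'cV[R]_(n + 1)) (I : 'rV[R]_(n + 1)) :
    wfa R (n + 1) :=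
  WFA I (letters (ext_mx B0 b0) (ext_mx B1 b1)) F.

Definition requirements (R : realType) (n : nat) (B0 B1 : 'M[R]_n)
    (b0 b1 : 'cV[R]_n) (F : 'cV[R]_(n + 1)) : Prop :=
  forall I : 'rV[R]_(n + 1), let A := ext_wfa B0 B1 b0 b1 F I in
    [/\ average_preserving A, omega_continuous A & hat_continuous A].

Definition solution (R : realType) (n : nat) (B0 B1 : 'M[R]_n)
    (b0 b1 : 'cV[R]_n) (F : 'cV[R]_(n + 1)) : Prop :=
  requirements B0 B1 b0 b1 F /\ ext_mx B0 b0 *m F <> F.

(* Algorithms over exact numbers: while programs that have registers for natural
   numbers and unbounded two-dimensional arrays of scalars.  The only operations
   on scalars are integer constants, exact addition, multiplication, division
   and equality testing.  The syntax does not mention R, so a program is a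
   finite object that contains no real constant, and one program treats
   inputs of every size. *)

Inductive nexp :=
| NConst of nat
| NReg of nat
| NAdd of nexp & nexp
| NSub of nexp & nexp
| NMul of nexp & nexp.

(* [SCell a i j] is the entry (i, j) of the array number a. *)
Inductive sexp :=
| SConst of int
| SCell of nat & nexp & nexp
| SAdd of sexp & sexp
| SMul of sexp & sexp.

Inductive test :=
| TEq of sexp & sexp
| TLe of nexp & nexp
| TNot of test
| TAnd of test & test.

(* [CDiv a i j e1 e2] stores e1 / e2 in the entry (i, j) of the array a. *)
Inductive cmd :=
| CSkip
| CReg of nat & nexp
| CCell of nat & nexp & nexp & sexp
| CDiv of nat & nexp & nexp & sexp & sexp
| CSeq of cmd & cmd
| CIf of test & cmd & cmd
| CWhile of test & cmd.

Record state (R : realType) := State {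
  reg : nat -> nat;
  arr : nat -> nat -> nat -> R }.

Section Semantics.
Variable R : realType.
Implicit Types s : state R.

Fixpoint neval s (e : nexp) : nat :=
  match e with
  | NConst k => k
  | NReg x => reg s x
  | NAdd e1 e2 => neval s e1 + neval s e2
  | NSub e1 e2 => neval s e1 - neval s e2
  | NMul e1 e2 => neval s e1 * neval s e2
  end%N.

Fixpoint seval s (e : sexp) : R :=
  match e with
  | SConst z => z%:~R
  | SCell a i j => arr s a (neval s i) (neval s j)
  | SAdd e1 e2 => seval s e1 + seval s e2
  | SMul e1 e2 => seval s e1 * seval s e2
  end.

Fixpoint teval s (t : test) : bool :=
  match t with
  | TEq e1 e2 => seval s e1 == seval s e2
  | TLe e1 e2 => (neval s e1 <= neval s e2)%N
  | TNot t1 => ~~ teval s t1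
  | TAnd t1 t2 => teval s t1 && teval s t2
  end.

Definition set_reg s (x k : nat) : state R :=
  State (fun y => if y == x then k else reg s y) (arr s).

Definition set_cell s (a i j : nat) (c : R) : state R :=
  State (reg s) (fun a' i' j' =>
    if [&& a' == a, i' == i & j' == j] then c else arr s a' i' j').

(* [exec c s s']: the program c, started in s, terminates in s'.  A division by
   zero has no result. *)
Inductive exec : cmd -> state R -> state R -> Prop :=
| ESkip s : exec CSkip s s
| EReg s x e : exec (CReg x e) s (set_reg s x (neval s e))
| ECell s a i j e :
    exec (CCell a i j e) s (set_cell s a (neval s i) (neval s j) (seval s e))
| EDiv s a i j e1 e2 : seval s e2 != 0 ->
    exec (CDiv a i j e1 e2) s
      (set_cell s a (neval s i) (neval s j) (seval s e1 / seval s e2))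
| ESeq s s1 s2 c1 c2 :
    exec c1 s s1 -> exec c2 s1 s2 -> exec (CSeq c1 c2) s s2
| EIfT s s1 t c1 c2 : teval s t -> exec c1 s s1 -> exec (CIf t c1 c2) s s1
| EIfF s s1 t c1 c2 : ~~ teval s t -> exec c2 s s1 -> exec (CIf t c1 c2) s s1
| EWhileF s t c : ~~ teval s t -> exec (CWhile t c) s s
| EWhileT s s1 s2 t c : teval s t ->
    exec c s s1 -> exec (CWhile t c) s1 s2 -> exec (CWhile t c) s s2.

Lemma exec_det (c : cmd) (s s1 s2 : state R) :
  exec c s s1 -> exec c s s2 -> s1 = s2.
Proof.
move=> h; elim: h s2 => {c s s1}.
- by move=> s s2 h; inversion h.
- by move=> s x e s2 h; inversion h.
- by move=> s a i j e s2 h; inversion h.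
- by move=> s a i j e1 e2 _ s2 h; inversion h.
- move=> s s1 s2 c1 c2 _ IH1 _ IH2 s3 h; inversion h; subst.
  by apply: IH2; rewrite (IH1 _ H1).
- move=> s s1 t c1 c2 ht _ IH s2 h; inversion h; subst; first exact: IH.
  by move: H4; rewrite ht.
- move=> s s1 t c1 c2 ht _ IH s2 h; inversion h; subst; last exact: IH.
  by move: H4; rewrite (negbTE ht).
- move=> s t c ht s2 h; inversion h; subst => //.
  by move: H1; rewrite (negbTE ht).
- move=> s s1 s2 t c ht _ IH1 _ IH2 s3 h; inversion h; subst.
    by move: H3; rewrite ht.
  by apply: IH2; rewrite (IH1 _ H2).
Qed.

Definition cells (m p : nat) (A : 'M[R]_(m, p)) (i j : nat) : R :=
  match insub i, insub j with
  | Some i', Some j' => A i' j'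
  | _, _ => 0
  end.

(* Input: the size in register 0, B0 in array 0 and B1 in array 1; all other
   registers and cells are zero. *)
Definition input_state (n : nat) (B0 B1 : 'M[R]_n) : state R :=
  State (fun x => if x == 0%N then n else 0%N)
        (fun a => match a with
                  | 0%N => cells B0
                  | 1%N => cells B1
                  | _ => fun _ _ => 0
                  end).

Definition output_col (m : nat) (s : state R) (a : nat) : 'cV[R]_m :=
  \col_(i < m) arr s a i 0.

End Semantics.

(* Output: b0 in array 2, b1 in array 3 and F in array 4, each in column 0. *)
Definition finds_solution (R : realType) (P : cmd) (n : nat)
    (B0 B1 : 'M[R]_n) : Prop :=
  exists2 s, exec P (input_state B0 B1) s &
    solution B0 B1 (output_col n s 2) (output_col n s 3)
      (output_col (n + 1) s 4).

(* Main.v *)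
Require Import Defs.
From HB Require Import structures.
From mathcomp Require Import all_boot all_order all_algebra.
From mathcomp Require Import all_classical all_reals all_analysis.
From mathcomp Require Import zify lra.

(* By König's lemma, products of long words over a stable set are uniformly small.
   Hence the sequences that define [f] converge uniformly, and [f] is continuous on
   words for every choice of b0, b1 and F.  Moreover [f (v a a a ...)] is [I A_v P_a]
   for the fixed vector P_a of A_a that has the same last coordinate as F, so
   continuity of [f] on numbers amounts to A_0 P_1 = A_1 P_0.  If p_0 and p_1 are the
   upper parts of P_0 and P_1, this says (B_0 + B_1 - E)(p_0 - p_1) = 0.

   If B_0 + B_1 - E is invertible, then P_0 = P_1; by average preservation F - P_0 is
   a solution of (B_0 + B_1) z = 2 z, which is 0, so A_0 F = A_1 F = F.

   Otherwise one may take p_0 = 0, p_1 = u and F = (f, 1), so b_0 = 0 and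
   b_1 = u - B_1 u, where (B_0 + B_1) u = u and (2E - B_0 - B_1) f = u - B_1 u.  This
   is a singular homogeneous linear system in (u, f), and all its nonzero solutions
   have f <> 0.  The algorithm computes a projection onto its kernel, one equation at
   a time, and returns a nonzero column of the projection. *)

Set Implicit Arguments.
Unset Strict Implicit.
Unset Printing Implicit Defensive.

Import Order.TTheory GRing.Theory Num.Theory.
Import numFieldNormedType.Exports.

Local Open Scope classical_set_scope.
Local Open Scope ring_scope.

(** * Binary expansions *)

Definition iword_tail (w : iword) : iword := fun i => w i.+1.

Definition iword_drop (k : nat) (w : iword) : iword := fun i => w (k + i)%N.

(** The default value of [nth] supplies the tail, so this is the word [v a a a ...]. *)
Definition iword_pad (v : seq bool) (a : bool) : iword := nth a v.

Lemma pref_recr k (w : iword) : pref k.+1 w = rcons (pref k w) (w k).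
Proof. by rewrite /pref /mkseq -addn1 iotaD map_cat cats1. Qed.

Lemma pref_recl k (w : iword) : pref k.+1 w = w 0 :: pref k (iword_tail w).
Proof. by rewrite /pref /mkseq /= (iotaDl 1) -map_comp. Qed.

Lemma pref_addn k l (w : iword) :
  pref (k + l) w = pref k w ++ pref l (iword_drop k w).
Proof.
by rewrite /pref /mkseq iotaD map_cat add0n -{2}[k]addn0 iotaDl -map_comp.
Qed.

Lemma pref_eqP k (w w' : iword) :
  pref k w = pref k w' <-> forall i, (i < k)%N -> w i = w' i.
Proof.
split=> [h i ik|h]; first by have /(congr1 (nth false ^~ i)) := h; rewrite !nth_mkseq.
by apply/eq_in_map => i; rewrite mem_iota => /andP[_ ik]; exact: h.
Qed.

Lemma pref_pad (v : seq bool) (a : bool) j :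
  pref (size v + j) (iword_pad v a) = v ++ nseq j a.
Proof.
rewrite pref_addn /pref mkseq_nth; congr (_ ++ _).
apply: (@eq_from_nth _ a); rewrite size_mkseq ?size_nseq // => i ij.
by rewrite nth_mkseq // nth_nseq ij /iword_drop /iword_pad nth_default // leq_addr.
Qed.

(** Greedy choice: the letter 0 is appended whenever [P] survives, and otherwise 1 must do. This
    serves both König's lemma and the averaging argument for [B0 z + B1 z = 2 z]. *)
Lemma iword_of_prefixes (P : seq bool -> Prop) :
  P [::] -> (forall v, P v -> exists a, P (rcons v a)) ->
  exists w : iword, forall k, P (pref k w).
Proof.
move=> P0 PS.
pose next v := if pselect (P (rcons v false)) then false else true.
pose u k := iter k (fun v => rcons v (next v)) [::].
have Pu k : P (u k).
  elim: k => //= k IH; rewrite /next; case: pselect => //= nP.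
  by have [[] //] := PS _ IH.
exists (fun k => next (u k)) => k.
suff -> : pref k (fun k => next (u k)) = u k by [].
by elim: k => // k IH; rewrite pref_recr IH.
Qed.

Lemma exp2_inv_small (R : realType) (e : R) : 0 < e -> exists k, 2 ^- k < e.
Proof.
move=> e0; have [k _ /(_ k (leqnn k))] := near_infty_natSinv_expn_lt (PosNum e0).
by rewrite div1r /= => h; exists k.
Qed.

Section Num.
Variable R : realType.
Local Notation num := (num_word R).
Implicit Types (w : iword) (k : nat) (x : R).

Let bits w : R^nat := fun i => (w i)%:R * 2 ^- i.+1.

Let series_bits_le1 w n : series (bits w) n <= 1.
Proof.
(* The sharper bound leaves room for the next digit in the induction. *)
suff: series (bits w) n <= 1 - 2 ^- n.
  by move/le_trans; apply; rewrite gerBl invr_ge0 exprn_ge0.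
elim: n => [|n IH]; first by rewrite seriesEnat /= big_geq // expr0 invr1 subrr.
rewrite seriesSr -[leRHS](subrK (1 - 2 ^- n)) addrC lerD //.
rewrite /bits exprS invfM; case: (w n); rewrite ?mul1r ?mul0r; first by lra.
have : 0 <= 2 ^- n :> R by rewrite invr_ge0 exprn_ge0.
by move=> h; lra.
Qed.

Lemma num_word_cvg w : series (bits w) @ \oo --> num w.
Proof.
apply: nondecreasing_is_cvgn; last by exists 1 => _ [n _ <-].
apply/nondecreasing_seqP => n; rewrite -subr_ge0 -[_ - _]/(series _ n.+1 - _).
by rewrite seriesSB mulr_ge0.
Qed.

Lemma num_word_ge0 w : 0 <= num w.
Proof.
apply: limr_ge; first by apply: cvgP; exact: num_word_cvg.
by apply: nearW => n; apply: sumr_ge0 => i _; rewrite mulr_ge0.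
Qed.

Lemma num_word_le1 w : num w <= 1.
Proof.
apply: limr_le; first by apply: cvgP; exact: num_word_cvg.
by apply: nearW => n; exact: series_bits_le1.
Qed.

Lemma num_word_rec w : num w = ((w 0)%:R + num (iword_tail w)) / 2.
Proof.
apply/cvg_lim => //.
rewrite -(@cvg_shiftS R).
have -> : [sequence series (bits w) n.+1]_n =
    (fun n => ((w 0)%:R + series (bits (iword_tail w)) n) / 2).
  apply/funext => n /=; rewrite /series /= big_nat_recl // mulrDl mulr_suml.
  congr (_ + _).
  by apply: eq_bigr => i _; rewrite /bits /iword_tail exprSr invfM mulrA.
apply: cvgMr_tmp; apply: cvgD; [exact: cvg_cst | exact: num_word_cvg].
Qed.


Lemma num_word_const (a : bool) : num (fun=> a) = a%:R.
Proof.
have : num (fun=> a) = (a%:R + num (fun=> a)) / 2 := num_word_rec (fun=> a).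
by move=> h; lra.
Qed.

(** A first letter other than [a] puts [num w] at distance at least 1/2 from the end point [a];
    dropping a first letter equal to [a] doubles the distance. *)
Lemma num_word_end (a : bool) k w :
  `|num w - a%:R| < 2 ^- k -> pref k w = nseq k a.
Proof.
elim: k w => // k IH w; rewrite num_word_rec exprS invfM => h.
have k1 : 2 ^- k <= 1 :> R by rewrite invf_le1 ?exprn_gt0 // exprn_ege1 // ler1n.
have t0 := num_word_ge0 (iword_tail w).
have t1 := num_word_le1 (iword_tail w).
have wa : w 0 = a.
  by apply/eqP; apply: contraT; move: h; rewrite ltr_norml => /andP[];
     case: (w 0); case: (a) => //= ? ?; exfalso; lra.
rewrite pref_recl wa /=; congr (_ :: _); apply: IH.
move: h; rewrite wa !ltr_norml => /andP[h1 h2].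
by apply/andP; case: (a) h1 h2 => /= h1 h2; split; lra.
Qed.

(** At the first difference the two numbers are separated by a midpoint, so closeness pushes the
    values of the two tails to opposite ends of [[0, 1]]; [num_word_end] then determines the letters
    up to [k]. *)
Lemma num_word_close k w w' : `|num w - num w'| < 2 ^- k ->
  pref k w = pref k w' \/
  exists v j b, pref k w = v ++ b :: nseq j (~~ b) /\
                pref k w' = v ++ ~~ b :: nseq j b.
Proof.
elim: k w w' => [|k IH] w w'; first by left.
rewrite (num_word_rec w) (num_word_rec w') exprS invfM => h.
have t0 := num_word_ge0 (iword_tail w).
have t1 := num_word_le1 (iword_tail w).
have t0' := num_word_ge0 (iword_tail w').
have t1' := num_word_le1 (iword_tail w').
rewrite !pref_recl; have [e|ne] := eqVneq (w 0) (w' 0).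
  have /IH : `|num (iword_tail w) - num (iword_tail w')| < 2 ^- k.
    by move: h; rewrite e !ltr_norml => /andP[h1 h2]; apply/andP; split; lra.
  case=> [->|[v [j [b [-> ->]]]]]; first by left; rewrite e.
  by right; exists (w 0 :: v), j, b; rewrite e.
have wN : w' 0 = ~~ w 0 by move: ne; case: (w 0); case: (w' 0).
right; exists [::], k, (w 0); rewrite wN /=.
move: h; rewrite wN ltr_norml => /andP[h1 h2].
split; congr (_ :: _); apply: num_word_end; rewrite ltr_norml; apply/andP;
  by case: (w 0) h1 h2 => /= h1 h2; split; lra.
Qed.

Lemma num_word_lt1 w : Omega w -> num w < 1.
Proof.
move=> Ow; rewrite lt_neqAle num_word_le1 andbT; apply/eqP => w1.
apply: Ow; exists 0 => i _.
have /num_word_end : `|num w - true%:R| < 2 ^- i.+1.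
  by rewrite w1 subrr normr0 invr_gt0 exprn_gt0.
by move/(congr1 (nth false ^~ i)); rewrite nth_mkseq // nth_nseq leqnn.
Qed.

Lemma Omega_tail w : Omega w -> Omega (iword_tail w).
Proof.
move=> Ow [k wk]; apply: Ow; exists k.+1 => -[//|i] ki; exact: wk.
Qed.

(** On [Omega] all tails have values strictly below 1, so comparison with 1/2 reveals the first
    letter. *)
Lemma num_word_inj w w' : Omega w -> Omega w' -> num w = num w' -> w = w'.
Proof.
have step v v' : Omega v -> Omega v' -> num v = num v' ->
    v 0 = v' 0 /\ num (iword_tail v) = num (iword_tail v').
  move=> Ov Ov'; rewrite (num_word_rec v) (num_word_rec v').
  have t0 := num_word_ge0 (iword_tail v).
  have t1 := num_word_lt1 (Omega_tail Ov).
  have t0' := num_word_ge0 (iword_tail v').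
  have t1' := num_word_lt1 (Omega_tail Ov').
  by case: (v 0); case: (v' 0) => //= h; split => //; lra.
move=> Ow Ow' h; apply/funext => i.
elim: i w w' Ow Ow' h => [|i IH] w w' Ow Ow' /(step _ _ Ow Ow')[//].
by move=> _; apply: IH; exact: Omega_tail.
Qed.

(* The doubling map, whose itineraries are the binary expansions. *)
Let double x : R := 2 * x - (1 / 2 <= x)%R%:R.

Let expansion x : iword := fun i => 1 / 2 <= iter i double x.

Let expansion_tail x : iword_tail (expansion x) = expansion (double x).
Proof. by apply/funext => i; rewrite /iword_tail /expansion iterSr. Qed.

Let double_itv x : 0 <= x < 1 -> 0 <= double x < 1.
Proof.
by rewrite /double => /andP[x0 x1]; case: (leP (1 / 2) x) => /= h; apply/andP; split; lra.
Qed.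

Let num_expansion x : 0 <= x < 1 -> num (expansion x) = x.
Proof.
move=> x01; apply/eqP; rewrite -subr_eq0 -normr_le0.
(* The doubling map acts on both numbers and doubles their difference, which never exceeds 1. *)
have close k : `|num (expansion x) - x| <= 2 ^- k.
  elim: k x x01 => [|k IH] x /[dup] /double_itv x01' /andP[x0 x1].
    have := num_word_ge0 (expansion x); have := num_word_le1 (expansion x).
    by move=> ? ?; rewrite ler_norml expr0 invr1; apply/andP; split; lra.
  have := IH _ x01'; rewrite (num_word_rec (expansion x)) expansion_tail.
  rewrite -[expansion x 0]/(1 / 2 <= x) exprS invfM !ler_norml.
  move: (num _) => y; rewrite /double; move: (_ <= _)%R%:R => d.
  by move=> /andP[h1 h2]; apply/andP; split; lra.
apply/ler_addgt0Pl => e e0; rewrite addr0.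
have [k ke] : exists k, 2 ^- k <= e.
  by have [k] := exp2_inv_small e0; exists k; exact: ltW.
exact: le_trans (close k) ke.
Qed.

(** Doubling removes the digits before a final run of ones, and a point of [[0, 1[] whose digits are
    all 1 would equal 1. *)
Let Omega_expansion x : 0 <= x < 1 -> Omega (expansion x).
Proof.
move=> x01 [k]; elim: k x x01 => [|k IH] x x01 xk; last first.
  apply: (IH _ (double_itv x01)) => i ki; rewrite -expansion_tail.
  exact: (xk i.+1).
have /andP[_] := x01; rewrite -(num_expansion x01).
suff -> : expansion x = fun=> true by rewrite num_word_const ltxx.
by apply/funext => i; apply: xk.
Qed.

Lemma bin_wordP x : 0 <= x < 1 ->
  Omega (bin_word x) /\ num (bin_word x) = x.
Proof.
move=> x01; apply: (@xgetPex _ (fun=> false) [set w | Omega w /\ num w = x]).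
by exists (expansion x); split; [exact: Omega_expansion | exact: num_expansion].
Qed.

Lemma bin_num_word w : Omega w -> bin_word (num w) = w.
Proof.
move=> Ow; have [|Ob] := @bin_wordP (num w).
  by rewrite num_word_ge0 num_word_lt1.
exact: num_word_inj.
Qed.

End Num.

(** * Matrix norms and continuity *)

(** Uniform continuity for [dC], phrased by prefixes. Uniformity matters in [glued_continuous],
    where the intermediate words depend on the moving point. *)
Definition prefix_modulus (R : realType) (f : iword -> R) :=
  forall e : R, 0 < e -> exists k, forall w w' : iword,
    pref k w = pref k w' -> `|f w - f w'| < e.

Lemma prefix_modulus_continuous_dC (R : realType) (f : iword -> R) :
  prefix_modulus f -> continuous_dC f.
Proof.
move=> fU w e /fU[k fk]; exists (2 ^- k); first by rewrite invr_gt0 exprn_gt0.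
move=> w'; rewrite /dC; case: pselect => [d|nd _]; last first.
  apply: fk; apply/pref_eqP => i _; apply: contrapT => /eqP ne.
  by apply: nd; exists i.
case: ex_minnP => m _ m_min.
rewrite ltf_pV2 ?posrE ?exprn_gt0 // ltr_eXn2l ?ltr1n // => km.
apply: fk; apply/pref_eqP => i ik; apply/eqP; apply: contraT => /m_min mi.
by move: (leq_trans (ltn_trans ik km) mi); rewrite ltnn.
Qed.

(* Two close numbers have expansions that share a long prefix, or that share long
   prefixes with the two expansions of a dyadic number, where [f] is glued. *)
Lemma glued_continuous (R : realType) (f : iword -> R) :
  prefix_modulus f ->
  (forall v b, f (iword_pad (rcons v b) (~~ b)) = f (iword_pad (rcons v (~~ b)) b)) ->
  {within `[0, 1[, continuous (fun x : R => f (bin_word x))}.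
Proof.
move=> fU fglue; apply/subspace_continuousP => x x01.
apply/cvgrPdist_lt => e e0.
have e2 : 0 < e / 2 by rewrite divr_gt0.
have [k fk] := fU _ e2.
have [xO xE] : Omega (bin_word x) /\ num_word R (bin_word x) = x.
  by apply: bin_wordP; move: x01; rewrite /= in_itv.
rewrite near_withinE /=; near=> y => y01.
have [yO yE] : Omega (bin_word y) /\ num_word R (bin_word y) = y.
  by apply: bin_wordP; move: y01; rewrite /= in_itv.
have : `|num_word R (bin_word x) - num_word R (bin_word y)| < 2 ^- k.
  rewrite xE yE; near: y.
  apply: (@cvgr_dist_lt _ R^o _ _ _ (fun y => y : R^o) x); first exact: cvg_id.
  by rewrite invr_gt0 exprn_gt0.
move=> /num_word_close[/fk h|[v [j [b [hx hy]]]]].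
  by apply: lt_trans h _; lra.
have kE : (size (rcons v b) + j = k)%N.
  have /(congr1 size) := hx.
  by rewrite size_mkseq size_cat /= size_nseq size_rcons addSnnS.
have hx' : pref k (bin_word x) = pref k (iword_pad (rcons v b) (~~ b)).
  by rewrite -{2}kE pref_pad cat_rcons.
have hy' : pref k (bin_word y) = pref k (iword_pad (rcons v (~~ b)) b).
  have -> : k = (size (rcons v (~~ b)) + j)%N by rewrite -kE !size_rcons.
  by rewrite pref_pad cat_rcons -hy -kE !size_rcons.
have h1 := fk _ _ hx'; have h2 := fk _ _ hy'; rewrite -fglue distrC in h2.
by rewrite (splitr e); exact: le_lt_trans (ler_distD _ _ _) (ltrD h1 h2).
Unshelve. all: by end_near. Qed.

Section MatrixSum.
Variable R : realType.

(** The entrywise l1 norm. It is submultiplicative for rectangular factors too, so rows, columns and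
    square matrices can share it. *)
Definition mxsum m n (A : 'M[R]_(m, n)) : R := \sum_i \sum_j `|A i j|.

Lemma mxsum_ge0 m n (A : 'M[R]_(m, n)) : 0 <= mxsum A.
Proof. by apply: sumr_ge0 => i _; apply: sumr_ge0. Qed.

Lemma mxsum_entry m n (A : 'M[R]_(m, n)) i j : `|A i j| <= mxsum A.
Proof.
rewrite /mxsum (bigD1 i) //= (bigD1 j) //= -addrA lerDl addr_ge0 //.
  exact: sumr_ge0.
by apply: sumr_ge0 => k _; apply: sumr_ge0.
Qed.

Lemma mxsumD m n (A B : 'M[R]_(m, n)) : mxsum (A + B) <= mxsum A + mxsum B.
Proof.
rewrite /mxsum -big_split; apply: ler_sum => i _; rewrite -big_split.
by apply: ler_sum => j _; rewrite mxE ler_normD.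
Qed.

Lemma mxsumM m n p (A : 'M[R]_(m, n)) (B : 'M[R]_(n, p)) :
  mxsum (A *m B) <= mxsum A * mxsum B.
Proof.
rewrite /mxsum mulr_suml; apply: ler_sum => i _; rewrite mulr_suml.
under eq_bigr do rewrite mxE.
apply: le_trans (_ : \sum_j \sum_k `|A i k| * `|B k j| <= _).
  apply: ler_sum => j _; apply: le_trans (ler_norm_sum _ _ _) _.
  by under eq_bigr do rewrite normrM.
rewrite exchange_big; apply: ler_sum => k _; rewrite -mulr_sumr.
apply: ler_wpM2l => //; rewrite [leRHS](bigD1 k) //= lerDl.
by apply: sumr_ge0 => l _; apply: sumr_ge0.
Qed.

Lemma mxsum_lt_near m n (A : nat -> 'M[R]_(m, n)) (e : R) :
  A @ \oo --> (0 : 'M[R]_(m, n)) -> 0 < e -> \forall k \near \oo, mxsum (A k) < e.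
Proof.
move=> A0 e0; pose d := e / (m * n).+1%:R.
have d0 : 0 < d by rewrite divr_gt0.
have : \forall k \near \oo, ball (0 : 'M[R]_(m, n)) d (A k).
  exact: (cvg_ball A0).
apply: filterS => k [_ Ak].
apply: (@le_lt_trans _ _ (\sum_(i < m) \sum_(j < n) d)).
  apply: ler_sum => i _; apply: ler_sum => j _.
  by have := Ak i j; rewrite /ball /= mxE sub0r normrN => /ltW.
rewrite !sumr_const !card_ord -mulrnA mulnC -mulr_natr /d mulrAC -mulrA.
by rewrite gtr_pMr // ltr_pdivrMr // mul1r ltr_nat.
Qed.

End MatrixSum.

(** * Stable sets of matrices *)

Section Mxword.
Variables (R : realType) (n : nat) (A : bool -> 'M[R]_n).

Lemma mxword_cons a v : mxword A (a :: v) = A a *m mxword A v.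
Proof. by rewrite /mxword big_cons. Qed.

Lemma mxword_nil : mxword A [::] = 1%:M.
Proof. by rewrite /mxword big_nil. Qed.

Lemma mxword_seq1 a : mxword A [:: a] = A a.
Proof. by rewrite mxword_cons mxword_nil mulmx1. Qed.

Lemma mxword_cat u v : mxword A (u ++ v) = mxword A u *m mxword A v.
Proof.
elim: u => [|a u IH] /=; first by rewrite mxword_nil mul1mx.
by rewrite !mxword_cons IH mulmxA.
Qed.

Lemma mxword_nseq_fix a k (z : 'cV[R]_n) :
  A a *m z = z -> mxword A (nseq k a) *m z = z.
Proof.
move=> az; elim: k => [|k IH] /=; first by rewrite mxword_nil mul1mx.
by rewrite mxword_cons -mulmxA IH.
Qed.

End Mxword.

Section Stable.
Variables (R : realType) (n : nat) (B0 B1 : 'M[R]_n).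
Hypothesis stab : stable B0 B1.
Local Notation B := (letters B0 B1).
Implicit Types (v u t : seq bool).

(* König's lemma: otherwise some infinite word has no prefix with a small product. *)
Lemma stable_contracting_prefix : exists N, forall w : iword,
  exists2 k, (0 < k <= N)%N & mxsum (mxword B (pref k w)) <= 1 / 2.
Proof.
pose good v := exists N, forall w : iword, pref (size v) w = v ->
  exists2 k, (0 < k <= N)%N & mxsum (mxword B (pref k w)) <= 1 / 2.
suff [N hN] : good [::] by exists N => w; apply: hN.
apply: contrapT => bad_nil.
have [|w bad_w] := @iword_of_prefixes (fun v => ~ good v) bad_nil.
  move=> v bad_v; apply: contrapT => no_bad; apply: bad_v.
  have good_next a : good (rcons v a).
    by apply: contrapT => bad_a; apply: no_bad; exists a.
  have [N0 h0] := good_next false; have [N1 h1] := good_next true.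
  exists (maxn N0 N1) => w wv.
  have : pref (size (rcons v (w (size v)))) w = rcons v (w (size v)).
    by rewrite size_rcons pref_recr wv.
  case: (w (size v)) => [/h1|/h0] [k /andP[k0 kN] hk]; exists k => //;
    by rewrite k0 leq_max kN ?orbT.
have half0 : 0 < 1 / 2 :> R by lra.
have [K _ hK] := mxsum_lt_near (stab w) half0.
(* The prefix of length [K.+1] is good because its own product is small; the successor keeps the
   block nonempty. *)
apply: (bad_w K.+1); exists K.+1; rewrite size_mkseq => w' ww'.
by exists K.+1; [rewrite /= leqnn | rewrite ww'; exact: ltW (hK _ (leqnSn K))].
Qed.

Lemma stable_contracting_block : exists N, forall v, (N <= size v)%N ->
  exists u t, [/\ v = u ++ t, (0 < size u <= N)%N & mxsum (mxword B u) <= 1 / 2].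
Proof.
have [N hN] := stable_contracting_prefix; exists N => v Nv.
have [k /andP[k0 kN] hk] := hN (iword_pad v false).
exists (take k v), (drop k v); rewrite cat_take_drop size_take_min.
have kv := leq_trans kN Nv.
rewrite (minn_idPl kv) k0 kN; split => //.
suff -> : take k v = pref k (iword_pad v false) by [].
have := pref_pad v false 0; rewrite addn0 cats0 => {1}<-.
by rewrite -{1}(subnKC kv) pref_addn take_size_cat ?size_mkseq.
Qed.

(** Splitting off a contracting block gives [g v <= M + g t / 2], and the bound [2 * M] reproduces
    itself. Here [g] stands for the norm of a product and, for automata, for the size of
    [A_v F - F]. *)
Lemma stable_bounded (g : seq bool -> R) :
  (forall u t, g (u ++ t) <= g u + mxsum (mxword B u) * g t) ->
  exists2 C, 0 <= C & forall v, g v <= C.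
Proof.
move=> gcat.
have short N : exists2 C, 0 <= C & forall v, (size v <= N)%N -> g v <= C.
  elim: N => [|N [C C0 IH]].
    by exists `|g [::]| => // -[_|//]; exact: ler_norm.
  pose C1 a := `|g [:: a]| + mxsum (mxword B [:: a]) * C.
  have C10 a : 0 <= C1 a by rewrite addr_ge0 // mulr_ge0 // mxsum_ge0.
  have [C1f C1t] := (C10 false, C10 true).
  exists (C + C1 false + C1 true); first by rewrite addr_ge0 // addr_ge0.
  case=> [_|a v].
    by apply: le_trans (IH [::] _) _ => //; rewrite -addrA lerDl addr_ge0.
  rewrite ltnS => /IH gv; apply: le_trans (gcat [:: a] v) _.
  apply: (@le_trans _ _ (C1 a)).
    by apply: lerD; [exact: ler_norm | rewrite ler_wpM2l // mxsum_ge0].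
  by case: a {gv}; lra.
have [N hN] := stable_contracting_block; have [M M0 hM] := short N.
exists (2 * M); first by rewrite mulr_ge0.
move=> v; have [m] := ubnP (size v); elim: m v => // m IH v.
rewrite ltnS => vm; have [vN|/ltnW/hN] := leqP (size v) N.
  by apply: le_trans (hM _ vN) _; lra.
case=> u [t [vE /andP[u0 uN] hu]]; rewrite vE.
apply: le_trans (gcat u t) _.
have gt : g t <= 2 * M.
  apply: IH; apply: leq_trans vm.
  by rewrite vE size_cat -[X in (X < _)%N]add0n ltn_add2r.
have gu := hM _ uN; have u1 := mxsum_ge0 (mxword B u).
have : mxsum (mxword B u) * g t <= mxsum (mxword B u) * (2 * M).
  exact: ler_wpM2l.
have : mxsum (mxword B u) * (2 * M) <= 1 / 2 * (2 * M).
  by apply: ler_wpM2r => //; rewrite mulr_ge0.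
by lra.
Qed.

(** Each contracting block halves the norm and has length at most [N], so words of length at least
    [j * N] have norm at most [C * 2 ^- j]. *)
Lemma stable_uniform (e : R) : 0 < e ->
  exists L, forall v, (L <= size v)%N -> mxsum (mxword B v) < e.
Proof.
move=> e0.
have [|C C0 hC] := @stable_bounded (fun v => mxsum (mxword B v)).
  by move=> u t; rewrite mxword_cat (le_trans (mxsumM _ _)) // lerDr mxsum_ge0.
have [N hN] := stable_contracting_block.
have decay j v : (j * N <= size v)%N -> mxsum (mxword B v) <= C * 2 ^- j.
  elim: j v => [|j IH] v; first by rewrite expr0 invr1 mulr1.
  move=> jv; have /hN[u [t [vE /andP[_ uN] hu]]] : (N <= size v)%N.
    by apply: leq_trans jv; rewrite mulSn leq_addr.
  rewrite vE mxword_cat; apply: le_trans (mxsumM _ _) _.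
  rewrite exprS invfM mulrCA -[2^-1]mul1r ler_pM ?mxsum_ge0 //; apply: IH.
  by rewrite -(leq_add2l N) -mulSn (leq_trans jv) // vE size_cat leq_add2r.
have [j hj] := @exp2_inv_small R (e / (C + 1)) ltac:(by rewrite divr_gt0 // ltr_wpDl).
exists (j * N)%N => v /decay /le_lt_trans; apply.
have C1 : 0 < C + 1 by rewrite ltr_wpDl.
move: hj; rewrite ltr_pdivlMr // => hj.
have : 0 < 2 ^- j :> R by rewrite invr_gt0 exprn_gt0.
by move=> p; lra.
Qed.

(** The vector [z] equals [B_a ^ L z] for every [L], and these powers tend to 0. *)
Lemma stable_fixed_eq0 a (z : 'cV[R]_n) : B a *m z = z -> z = 0.
Proof.
move=> az; apply/matrixP => i j; rewrite mxE; apply/eqP; rewrite -normr_le0.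
have z1 : 0 < mxsum z + 1 by rewrite ltr_wpDl // mxsum_ge0.
apply/ler_addgt0Pl => e e0; rewrite addr0.
have [|L hL] := @stable_uniform (e / (mxsum z + 1)); first by rewrite divr_gt0.
rewrite -(mxword_nseq_fix L az).
apply: le_trans (mxsum_entry _ _ _) _; apply: le_trans (mxsumM _ _) _.
have := hL (nseq L a); rewrite size_nseq leqnn => /(_ isT).
rewrite ltr_pdivlMr // => h; have := mxsum_ge0 (mxword B (nseq L a)) => *; lra.
Qed.

(* For every functional, averaging selects a letter that does not decrease its value
   at [z]; along the resulting infinite word the products tend to 0. *)
Lemma stable_average_eq0 (z : 'cV[R]_n) : B0 *m z + B1 *m z = 2 *: z -> z = 0.
Proof.
move=> avg; apply/matrixP => i j; rewrite mxE; apply/eqP; rewrite -normr_le0.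
have [||w hw] := @iword_of_prefixes (fun v => `|z i j| <= `|(mxword B v *m z) i j|).
- by rewrite mxword_nil mul1mx.
- move=> v hv.
  have e : (mxword B (rcons v false) *m z) i j + (mxword B (rcons v true) *m z) i j
      = 2 * (mxword B v *m z) i j.
    rewrite -cats1 -[rcons v true]cats1 !mxword_cat !mxword_seq1 -!mulmxA /=.
    have -> : 2 * (mxword B v *m z) i j = (mxword B v *m (2 *: z)) i j.
      by rewrite -scalemxAr [RHS]mxE.
    by rewrite -avg mulmxDr [RHS]mxE.
  (* The two values add up to twice a number of absolute value at least [|z i j|], so they cannot
     both be smaller. *)
  apply: contrapT => no.
  have lt a : `|(mxword B (rcons v a) *m z) i j| < `|z i j|.
    by rewrite ltNge; apply/negP => le; apply: no; exists a.
  have := ler_normD ((mxword B (rcons v false) *m z) i j)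
                    ((mxword B (rcons v true) *m z) i j).
  rewrite e normrM ger0_norm //.
  by have := lt false; have := lt true; clear avg => *; lra.
apply/ler_addgt0Pl => e e0; rewrite addr0.
have z1 : 0 < mxsum z + 1 by rewrite ltr_wpDl // mxsum_ge0.
have [|L hL] := @stable_uniform (e / (mxsum z + 1)); first by rewrite divr_gt0.
apply: le_trans (hw L) _.
apply: le_trans (mxsum_entry _ _ _) _; apply: le_trans (mxsumM _ _) _.
have := hL (pref L w); rewrite size_mkseq leqnn => /(_ isT).
rewrite ltr_pdivlMr // => h; have := mxsum_ge0 (mxword B (pref L w)) => *; lra.
Qed.

End Stable.

(** * Automata with block triangular matrices *)

Lemma mxsum_usubmx (R : realType) m n (z : 'cV[R]_(m + n)) :
  mxsum (usubmx z) <= mxsum z.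
Proof.
rewrite /mxsum big_split_ord /= -[leLHS]addr0 lerD //.
  by apply: ler_sum => i _; apply: ler_sum => j _; rewrite mxE.
by apply: sumr_ge0 => i _; apply: sumr_ge0.
Qed.

Lemma mxsum_col0 (R : realType) m n (z : 'cV[R]_m) :
  mxsum (col_mx z (0 : 'cV[R]_n)) = mxsum z.
Proof.
rewrite /mxsum big_split_ord /= [X in _ + X]big1 ?addr0 => [|i _].
  by apply: eq_bigr => i _; apply: eq_bigr => j _; rewrite col_mxEu.
by rewrite big1 // => j _; rewrite col_mxEd mxE normr0.
Qed.

Section Extension.
Variables (R : realType) (n : nat) (B0 B1 : 'M[R]_n) (b0 b1 : 'cV[R]_n).
Local Notation B := (letters B0 B1).
Local Notation b := (letters b0 b1).
Local Notation A := (letters (ext_mx B0 b0) (ext_mx B1 b1)).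
Implicit Types (v u t : seq bool) (z F P : 'cV[R]_(n + 1)) (I : 'rV[R]_(n + 1)).

Lemma ext_mxE a z :
  A a *m z = col_mx (B a *m usubmx z + b a *m dsubmx z) (dsubmx z).
Proof.
by case: a; rewrite -{1}[z]vsubmxK /= mul_block_col mul0mx mul1mx add0r.
Qed.

Lemma mxword_ext_dsubmx v z : dsubmx (mxword A v *m z) = dsubmx z.
Proof.
elim: v => [|a v IH]; first by rewrite mxword_nil mul1mx.
by rewrite mxword_cons -mulmxA ext_mxE col_mxKd.
Qed.

(** With last coordinate 0 the columns [b0] and [b1] never act, and only the stable products remain.
    The estimates below apply this to differences of vectors with equal last coordinates. *)
Lemma mxword_ext_diff v z : dsubmx z = 0 ->
  mxword A v *m z = col_mx (mxword B v *m usubmx z) 0.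
Proof.
move=> z0; elim: v => [|a v IH]; first by rewrite !mxword_nil !mul1mx -z0 vsubmxK.
by rewrite !mxword_cons -mulmxA IH ext_mxE col_mxKd col_mxKu mulmx0 addr0 mulmxA.
Qed.

Lemma mxword_ext_bound I v z : dsubmx z = 0 ->
  `|(I *m mxword A v *m z) 0 0| <= mxsum I * (mxsum (mxword B v) * mxsum z).
Proof.
move=> z0; apply: le_trans (mxsum_entry _ _ _) _.
rewrite -mulmxA mxword_ext_diff //; apply: le_trans (mxsumM _ _) _.
rewrite ler_wpM2l ?mxsum_ge0 // mxsum_col0; apply: le_trans (mxsumM _ _) _.
by rewrite ler_wpM2l ?mxsum_ge0 ?mxsum_usubmx.
Qed.

Hypothesis stab : stable B0 B1.

Lemma stable_mxword_ext_small (C e : R) I : 0 < e -> exists L, forall v z,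
  (L <= size v)%N -> dsubmx z = 0 -> mxsum z <= C ->
  `|(I *m mxword A v *m z) 0 0| < e.
Proof.
move=> e0; pose D := mxsum I * `|C| + 1.
have D0 : 0 < D by rewrite ltr_wpDl // mulr_ge0 ?mxsum_ge0.
have [|L hL] := stable_uniform stab (e := e / D); first by rewrite divr_gt0.
exists L => v z /hL; rewrite ltr_pdivlMr // => hv z0 zC.
apply: le_lt_trans (mxword_ext_bound _ _ z0) _; apply: le_lt_trans hv.
rewrite mulrCA ler_wpM2l ?mxsum_ge0 //.
apply: (@le_trans _ _ (mxsum I * `|C|)); last by rewrite lerDl.
by rewrite ler_wpM2l ?mxsum_ge0 // (le_trans zC) // ler_norm.
Qed.

(** The identity [A_u A_t F - F = (A_u F - F) + A_u (A_t F - F)] gives the inequality of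
    [stable_bounded], because [A_t F - F] has last coordinate 0. *)
Lemma stable_ext_bounded F : exists C, forall v, mxsum (mxword A v *m F - F) <= C.
Proof.
have [|C _ hC] := stable_bounded stab (g := fun v => mxsum (mxword A v *m F - F));
  last by exists C.
move=> u t; rewrite mxword_cat.
have -> : mxword A u *m mxword A t *m F - F =
    (mxword A u *m F - F) + mxword A u *m (mxword A t *m F - F).
  by rewrite mulmxBr mulmxA [RHS]addrC addrA subrK.
apply: le_trans (mxsumD _ _) _; rewrite lerD2l mxword_ext_diff; last first.
  by rewrite raddfB /= mxword_ext_dsubmx subrr.
rewrite mxsum_col0; apply: le_trans (mxsumM _ _) _.
by rewrite ler_wpM2l ?mxsum_ge0 ?mxsum_usubmx.
Qed.

(** The letters after the first [L] move [F] by a bounded vector with last coordinate 0, which the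
    product of the first [L] matrices makes small. *)
Lemma omega_seq_uniform I F (e : R) : 0 < e -> exists L, forall w k, (L <= k)%N ->
  `|omega_seq (ext_wfa B0 B1 b0 b1 F I) w k -
    omega_seq (ext_wfa B0 B1 b0 b1 F I) w L| < e.
Proof.
move=> e0; have [C hC] := stable_ext_bounded F.
have [L hL] := stable_mxword_ext_small C I e0.
exists L => w k /subnKC <-; rewrite /omega_seq /= pref_addn mxword_cat.
set u := pref L w; set t := pref _ _.
have -> : (I *m (mxword A u *m mxword A t) *m F) 0 0 - (I *m mxword A u *m F) 0 0
    = (I *m mxword A u *m (mxword A t *m F - F)) 0 0.
  by rewrite mulmxBr !mulmxA [RHS]mxE [X in _ = _ + X]mxE.
apply: hL => //; first by rewrite size_mkseq.
by rewrite raddfB /= mxword_ext_dsubmx subrr.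
Qed.

Lemma omega_seq_cvgn I F w : omega_defined (ext_wfa B0 B1 b0 b1 F I) w.
Proof.
apply: cauchy_cvg; apply: cauchy_exP => e e0.
have [L hL] := omega_seq_uniform I F e0.
exists (omega_seq (ext_wfa B0 B1 b0 b1 F I) w L); exists L => // k /= Lk.
by rewrite /ball /= distrC hL.
Qed.

Lemma omega_fun_modulus I F : prefix_modulus (omega_fun (ext_wfa B0 B1 b0 b1 F I)).
Proof.
move=> e e0; have e3 : 0 < e / 3 by rewrite divr_gt0.
have [L hL] := omega_seq_uniform I F e3; exists L => w w' ww'.
have close (v : iword) : `|omega_fun (ext_wfa B0 B1 b0 b1 F I) v -
    omega_seq (ext_wfa B0 B1 b0 b1 F I) v L| <= e / 3.
  rewrite ler_distl; apply/andP; split; [apply: limr_ge | apply: limr_le];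
    try exact: omega_seq_cvgn.
    by exists L => // k /= /(hL v); rewrite ltr_distl => /andP[/ltW].
  by exists L => // k /= /(hL v); rewrite ltr_distl => /andP[_ /ltW].
have := close w; have := close w'; rewrite /omega_seq -ww'.
rewrite !ler_distl ltr_distl => /andP[h1 h2] /andP[h3 h4].
by apply/andP; split; lra.
Qed.

Lemma omega_ext_continuous I F : omega_continuous (ext_wfa B0 B1 b0 b1 F I).
Proof.
split=> [w|]; first exact: omega_seq_cvgn.
exact/prefix_modulus_continuous_dC/omega_fun_modulus.
Qed.

(** Since [A_a P = P], the term at [v] followed by [j] letters [a] differs from [I A_v P] by a long
    product applied to [P - F]. *)
Lemma omega_fun_pad I F P a v : A a *m P = P -> dsubmx P = dsubmx F ->
  omega_fun (ext_wfa B0 B1 b0 b1 F I) (iword_pad v a) = (I *m mxword A v *m P) 0 0.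
Proof.
move=> aP PF; apply/cvg_lim => //; apply/cvgrPdist_lt => e e0.
have [L hL] := stable_mxword_ext_small (mxsum (P - F)) I e0.
exists (size v + L)%N => // k /= kL.
rewrite /omega_seq /= -(subnKC (leq_trans (leq_addr _ _) kL)) pref_pad.
set j := (k - size v)%N.
have -> : (I *m mxword A v *m P) 0 0 - (I *m mxword A (v ++ nseq j a) *m F) 0 0
    = (I *m mxword A (v ++ nseq j a) *m (P - F)) 0 0.
  rewrite mulmxBr [RHS]mxE [X in _ = _ + X]mxE; congr (_ - _).
  by rewrite mxword_cat -!mulmxA mxword_nseq_fix.
apply: hL => //.
  rewrite size_cat size_nseq (leq_trans _ (leq_addl _ _)) // leq_subRL //.
  exact: leq_trans (leq_addr _ _) kL.
by rewrite raddfB /= PF subrr.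
Qed.

(** The words [v 0 1 1 1 ...] and [v 1 0 0 0 ...] have the values [I A_v A_0 P_1] and
    [I A_v A_1 P_0], which the last hypothesis makes equal. *)
Lemma ext_requirements F (P : bool -> 'cV[R]_(n + 1)) :
  A false *m F + A true *m F = 2 *: F ->
  (forall a, A a *m P a = P a) -> (forall a, dsubmx (P a) = dsubmx F) ->
  A false *m P true = A true *m P false ->
  requirements B0 B1 b0 b1 F.
Proof.
move=> avg PA PF glue I /=; split=> //; first exact: omega_ext_continuous.
split=> [x _|]; first exact: omega_seq_cvgn.
apply: glued_continuous; first exact: omega_fun_modulus.
move=> v c; rewrite (omega_fun_pad _ _ (PA _) (PF _)) (omega_fun_pad _ _ (PA _) (PF _)).
rewrite -!cats1 !mxword_cat !mxword_seq1 -!mulmxA.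
by case: c; rewrite /= glue.
Qed.

Lemma Omega_pad_false v : Omega (iword_pad v false).
Proof.
move=> [k hk]; have := hk (k + size v)%N (leq_addr _ _).
by rewrite /iword_pad nth_default // leq_addl.
Qed.

Lemma num_word_pad_true_false k :
  num_word R (iword_pad (nseq k true) false) = 1 - 2 ^- k.
Proof.
elim: k => [|k IH]; rewrite num_word_rec /=.
  have -> : iword_tail (iword_pad [::] false) = fun=> false.
    by apply/funext => i; rewrite /iword_tail /iword_pad nth_nil.
  by rewrite num_word_const expr0 invr1 subrr addr0 mul0r.
rewrite -[iword_tail _]/(iword_pad (nseq k true) false) IH exprS invfM /=.
by lra.
Qed.

(* The value at 1/2 is taken along 1000..., while the words 01^k000... represent
   numbers that tend to 1/2 from below. *)
Lemma requirements_glue F (P : bool -> 'cV[R]_(n + 1)) :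
  requirements B0 B1 b0 b1 F ->
  (forall a, A a *m P a = P a) -> (forall a, dsubmx (P a) = dsubmx F) ->
  A false *m P true = A true *m P false.
Proof.
move=> req PA PF.
(* Unit rows for [I] turn equality of the values into equality of the vectors. *)
suff glue I : (I *m (A false *m P true)) 0 0 = (I *m (A true *m P false)) 0 0.
  apply/matrixP => i j; have := glue (delta_mx 0 i).
  by rewrite -!rowE !mxE (ord1 j).
have [_ _ [_ /subspace_continuousP]] := req I.
pose w k := iword_pad (false :: nseq k true) false.
pose f := omega_fun (ext_wfa B0 B1 b0 b1 F I).
have wE k : num_word R (w k) = 1 / 2 - 2 ^- k.+1.
  rewrite num_word_rec -[iword_tail _]/(iword_pad (nseq k true) false).
  by rewrite num_word_pad_true_false exprS invfM /w /=; lra.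
have halfE : num_word R (iword_pad [:: true] false) = 1 / 2.
  by rewrite (num_word_pad_true_false 1) expr1; lra.
have in01 k : num_word R (w k) \in `[0, 1[.
  rewrite in_itv /= num_word_ge0 num_word_lt1 //; exact: Omega_pad_false.
move=> /(_ (1 / 2)); rewrite /= in_itv /= => /(_ ltac:(apply/andP; split; lra)).
have hatE u : hat_fun (ext_wfa B0 B1 b0 b1 F I) (num_word R (iword_pad u false)) =
    (I *m mxword A u *m P false) 0 0.
  by rewrite /hat_fun bin_num_word ?(omega_fun_pad _ _ (PA _) (PF _)) //; exact: Omega_pad_false.
rewrite -halfE => hatc.
rewrite !mulmxA; apply/eqP; rewrite -subr_eq0 -normr_le0.
apply/ler_addgt0Pl => e e0; rewrite addr0.
have e2 : 0 < e / 2 by rewrite divr_gt0.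
move/cvgrPdist_lt: hatc => /(_ _ e2); rewrite /from_subspace hatE mxword_seq1 near_withinE.
move=> /nbhs_ballP[d /= d0 hd].
have [k0 hk0] := exp2_inv_small d0.
have [L hL] := stable_mxword_ext_small (mxsum (P false - P true)) I e2.
(* [k0] brings the number of [w k] within [d] of 1/2, and [L] allows [P true] to replace [P false]
   behind the block of ones. *)
pose k := maxn k0 L.
have close : `|(I *m A true *m P false) 0 0 -
               (I *m mxword A (false :: nseq k true) *m P false) 0 0| < e / 2.
  rewrite -[X in _ - X]hatE; apply: hd; last exact: in01.
  rewrite /ball /= halfE wE opprB addrCA subrr addr0 ger0_norm ?invr_ge0 ?exprn_ge0 //.
  apply: le_lt_trans hk0; rewrite lef_pV2 ?posrE ?exprn_gt0 //.
  by rewrite ler_eXn2l ?ltr1n // leqW // leq_maxl.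
have : `|(I *m mxword A (false :: nseq k true) *m (P false - P true)) 0 0| < e / 2.
  apply: hL => //=; first by rewrite size_nseq leqW // leq_maxr.
  by rewrite raddfB /= !PF subrr.
have -> : (I *m mxword A (false :: nseq k true) *m (P false - P true)) 0 0 =
    (I *m mxword A (false :: nseq k true) *m P false) 0 0 -
    (I *m A false *m P true) 0 0.
  rewrite mulmxBr [LHS]mxE [X in _ + X = _]mxE; congr (_ - _).
  by rewrite mxword_cons -!mulmxA mxword_nseq_fix.
move: close; rewrite !ltr_norml ler_norml => /andP[? ?] /andP[? ?].
by apply/andP; split; lra.
Qed.

End Extension.

(** * Solutions *)

Lemma det0_colP (K : fieldType) m (M : 'M[K]_m) :
  \det M = 0 -> exists2 z : 'cV[K]_m, z != 0 & M *m z = 0.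
Proof.
move=> M0; have /det0P[v v0 vM] : \det M^T == 0 by rewrite det_tr M0.
by exists v^T; [rewrite trmx_eq0 | rewrite -[M]trmxK -trmx_mul vM trmx0].
Qed.

Section Solutions.
Variables (R : realType) (n : nat) (B0 B1 : 'M[R]_n).
Hypothesis stab : stable B0 B1.
Local Notation B := (letters B0 B1).

(** A kernel vector of [E - B_a] would be fixed by [B_a]. *)
Lemma stable_sub1_unitmx a : 1%:M - B a \in unitmx.
Proof.
rewrite unitmxE unitfE; apply/eqP => /det0_colP[z z0].
rewrite mulmxBl mul1mx => /subr0_eq /esym /(stable_fixed_eq0 stab) ze.
by rewrite ze eqxx in z0.
Qed.

Lemma requirements_fixed (b0 b1 : 'cV[R]_n) (F : 'cV[R]_(n + 1)) :
  \det (B0 + B1 - 1%:M) <> 0 -> requirements B0 B1 b0 b1 F ->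
  forall a, letters (ext_mx B0 b0) (ext_mx B1 b1) a *m F = F.
Proof.
move=> detG req.
have [avg _ _] := req 0; rewrite /average_preserving /= in avg.
(* [p a] solves [p = B_a p + b_a d] with [d] the last coordinate of [F]; stacked on [d] it is a
   fixed vector of [A_a]. *)
pose p a := invmx (1%:M - B a) *m letters b0 b1 a *m dsubmx F.
have pE a : letters b0 b1 a *m dsubmx F = p a - B a *m p a.
  rewrite -[X in _ = X - _]mul1mx -mulmxBl /p !mulmxA mulmxV ?mul1mx //.
  exact: stable_sub1_unitmx.
pose P a := col_mx (p a) (dsubmx F).
have PF a : dsubmx (P a) = dsubmx F by rewrite col_mxKd.
have PA a : letters (ext_mx B0 b0) (ext_mx B1 b1) a *m P a = P a.
  by rewrite ext_mxE col_mxKu col_mxKd pE addrC subrK.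
have /(congr1 usubmx) := requirements_glue stab req PA PF.
rewrite !ext_mxE !col_mxKu !col_mxKd (pE false) (pE true) /= => glue.
have p01 : p false = p true.
  apply/subr0_eq; apply/eqP; apply: contraT => d0; exfalso; apply: detG.
  apply/eqP; rewrite -det_tr; apply/det0P; exists (p false - p true)^T.
    by rewrite trmx_eq0.
  rewrite -trmx_mul -[RHS]trmx0; congr (_^T).
  rewrite mulmxBl mulmxDl mul1mx !mulmxBr.
  move: glue; move: (B0 *m p false) (B0 *m p true) (B1 *m p false) (B1 *m p true).
  move: (p false) (p true); clear=> p0 p1 x y z t e; apply/matrixP => i j.
  have := congr1 (fun M : 'cV[R]_n => M i j) e; clear e.
  by rewrite !mxE => e; lra.
have Pc : P false = P true by rewrite /P p01.
(* Both matrices fix [P true], so [F - P true] inherits the averaging equation; as its last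
   coordinate is 0, that equation involves only [B0] and [B1]. *)
have FP : F = P true.
  apply/subr0_eq; rewrite -[F - _]vsubmxK.
  have d0 : dsubmx (F - P true) = 0 by rewrite raddfB /= PF subrr.
  rewrite d0; suff -> : usubmx (F - P true) = 0 by rewrite col_mx0.
  apply: (stable_average_eq0 stab).
  have : letters (ext_mx B0 b0) (ext_mx B1 b1) false *m (F - P true) +
      letters (ext_mx B0 b0) (ext_mx B1 b1) true *m (F - P true) =
      2 *: (F - P true).
    rewrite !mulmxBr PA -{1}Pc PA Pc addrACA avg -opprD scalerBr.
    by rewrite [X in _ = _ - X]scaler_nat mulr2n.
  move/(congr1 usubmx); rewrite !ext_mxE d0 !mulmx0 !addr0 add_col_mx col_mxKu /=.
  by move=> ->; rewrite linearZ.
by case; rewrite FP ?PA // -Pc PA.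
Qed.

Lemma fixed_omega_constant (b0 b1 : 'cV[R]_n) (F : 'cV[R]_(n + 1)) I :
  (forall a, letters (ext_mx B0 b0) (ext_mx B1 b1) a *m F = F) ->
  omega_constant (ext_wfa B0 B1 b0 b1 F I).
Proof.
move=> fixF; exists ((I *m F) 0 0) => w.
suff -> : omega_seq (ext_wfa B0 B1 b0 b1 F I) w = fun=> (I *m F) 0 0 by exact: cvg_cst.
apply/funext => k; rewrite /omega_seq /= -mulmxA; congr ((_ *m _) 0 0).
elim: (pref k w) => [|a v IH]; first by rewrite mxword_nil mul1mx.
by rewrite mxword_cons -mulmxA IH.
Qed.

(** The unknown is [u] stacked on [f]. Keeping [f] among the unknowns makes the system homogeneous,
    so a single kernel vector provides the whole output. *)
Definition kernel_system : 'M[R]_(n + n) :=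
  block_mx (1%:M - B0 - B1) 0 (B1 - 1%:M) (2%:M - B0 - B1).

(** The system is block triangular, and its upper left block is [-(B0 + B1 - E)]. *)
Lemma det_kernel_system : \det (B0 + B1 - 1%:M) = 0 -> \det kernel_system = 0.
Proof.
move=> detG; rewrite det_lblock; apply/eqP; rewrite mulf_eq0; apply/orP; left.
have -> : 1%:M - B0 - B1 = - 1 *: (B0 + B1 - 1%:M).
  by rewrite scaleN1r opprB opprD addrA.
by rewrite detZ detG mulr0.
Qed.

Lemma kernel_system_solution (z : 'cV[R]_(n + n)) :
  kernel_system *m z = 0 -> z != 0 ->
  solution B0 B1 0 (usubmx z - B1 *m usubmx z) (col_mx (dsubmx z) 1%:M).
Proof.
rewrite -[z]vsubmxK; move: (usubmx z) (dsubmx z) => u f {z}.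
rewrite mul_block_col mul0mx addr0 => /(congr1 (fun z => (usubmx z, dsubmx z))).
rewrite !col_mxKu !col_mxKd !raddf0 => -[eu ef] z0.
have {}eu : B0 *m u + B1 *m u = u.
  by move: eu; rewrite !mulmxBl mul1mx -addrA -opprD => /subr0_eq/esym.
have {}ef : B0 *m f + (B1 *m f + (u - B1 *m u)) = 2 *: f.
  move: ef; rewrite !mulmxBl mul1mx mul_scalar_mx.
  move: (B0 *m f) (B1 *m f) (B1 *m u); clear=> x y t e; apply/matrixP => i j.
  have := congr1 (fun M : 'cV[R]_n => M i j) e; clear e.
  by rewrite !mxE => e; lra.
(* For [f = 0] the second equation says [B1 u = u], and stability gives [u = 0]. *)
have f0 : f != 0.
  apply: contraNneq z0 => f0; rewrite f0 !mulmx0 scaler0 !add0r in ef.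
  have u0 : u = 0 by apply: (@stable_fixed_eq0 _ _ _ _ stab true); exact/esym/subr0_eq.
  by rewrite f0 u0 col_mx0.
split.
  (* The fixed vectors are [P_0 = (0, 1)] and [P_1 = (u, 1)]; gluing them is the equation
     [B0 u = u - B1 u]. *)
  pose P (a : bool) : 'cV[R]_(n + 1) := col_mx (if a then u else 0) 1%:M.
  apply: (ext_requirements (P := P) stab).
  - rewrite !ext_mxE /= !col_mxKu !col_mxKd mul0mx addr0 mulmx1.
    by rewrite add_col_mx ef scale_col_mx; congr col_mx; rewrite scaler_nat mulr2n.
  - case; rewrite ext_mxE /= !col_mxKu !col_mxKd /P ?mulmx1 ?mulmx0 ?mul0mx ?addr0 //.
    by rewrite addrC subrK.
  - by move=> a; rewrite !col_mxKd.
  - rewrite !ext_mxE /= !col_mxKu !col_mxKd mul0mx mulmx0 add0r addr0 mulmx1.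
    by rewrite -{2}eu addrK.
(* As [b0 = 0], the equality [A_0 F = F] would make [f] a fixed vector of [B0], hence 0. *)
rewrite (ext_mxE B0 B1 0 (u - B1 *m u) false) /= col_mxKu col_mxKd mul0mx addr0.
move=> /(congr1 usubmx); rewrite !col_mxKu => /(@stable_fixed_eq0 _ _ _ _ stab false).
by move/eqP; apply/negP.
Qed.

End Solutions.

(** * Total correctness of programs *)

(** The bound is evaluated anew before each round, which is why [terminates_for] asks that it keep
    its value. *)
Definition CFor (r : nat) (b : nexp) (body : cmd) : cmd :=
  CSeq (CReg r (NConst 0))
    (CWhile (TLe (NAdd (NReg r) (NConst 1)) b)
      (CSeq body (CReg r (NAdd (NReg r) (NConst 1))))).

Definition SSub (e1 e2 : sexp) : sexp := SAdd e1 (SMul (SConst (-1)) e2).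

(* In e, the registers 2 and 3 contain indices relative to the block of the array a that
   starts at (o1, o2). *)
Definition CTable (a : nat) (o1 b1 o2 b2 : nexp) (e : sexp) : cmd :=
  CFor 2 b1 (CFor 3 b2
    (CCell a (NAdd o1 (NReg 2)) (NAdd o2 (NReg 3)) e)).

(** Register 4 receives the last index at which [e] is nonzero, and keeps its old value if there is
    none. *)
Definition CFind (b : nexp) (e : sexp) : cmd :=
  CFor 2 b (CIf (TNot (TEq e (SConst 0))) (CReg 4 (NReg 2)) CSkip).

Section TotalCorrectness.
Variable R : realType.
Implicit Types (s : state R) (Q : state R -> Prop) (xs aa : seq nat).

(** Total correctness with the postcondition last, so that the rules can be applied along a program
    from left to right. *)
Definition terminates c s Q := exists2 s', exec c s s' & Q s'.

Lemma terminates_seq c1 c2 s Q :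
  terminates c1 s (fun s1 => terminates c2 s1 Q) -> terminates (CSeq c1 c2) s Q.
Proof. by move=> [s1 e1 [s2 e2 q]]; exists s2 => //; apply: ESeq e1 e2. Qed.

Lemma terminates_cell a i j e s Q :
  Q (set_cell s a (neval s i) (neval s j) (seval s e)) -> terminates (CCell a i j e) s Q.
Proof. by move=> q; eexists; [exact: ECell | exact: q]. Qed.

Lemma terminates_if t c1 c2 s Q :
  (teval s t -> terminates c1 s Q) -> (~~ teval s t -> terminates c2 s Q) ->
  terminates (CIf t c1 c2) s Q.
Proof.
case: (boolP (teval s t)) => ht h1 h2.
  by have [s1 e1 q] := h1 isT; exists s1 => //; apply: EIfT.
by have [s1 e1 q] := h2 isT; exists s1 => //; apply: EIfF.
Qed.

Definition frame xs aa s s' :=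
  (forall x, x \notin xs -> reg s' x = reg s x) /\
  (forall a, a \notin aa -> arr s' a = arr s a).

Lemma frame_trans xs aa s1 s2 s3 :
  frame xs aa s1 s2 -> frame xs aa s2 s3 -> frame xs aa s1 s3.
Proof.
move=> [r12 a12] [r23 a23]; split=> [x h|a h]; first by rewrite r23 ?r12.
by rewrite a23 ?a12.
Qed.

Lemma frame_weaken xs aa xs' aa' s s' :
  all (mem xs') xs -> all (mem aa') aa -> frame xs aa s s' -> frame xs' aa' s s'.
Proof.
move=> /allP hx /allP ha [hr h]; split=> [x xn|a an].
  by apply: hr; apply: contra xn => /hx.
by apply: h; apply: contra an => /ha.
Qed.

Lemma frame_reg xs aa s r k : r \in xs -> frame xs aa s (set_reg s r k).
Proof.
move=> rx; split=> [x xn|//] /=; case: eqP => // e.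
by rewrite e rx in xn.
Qed.

Lemma frame_cell xs aa s a i j c : a \in aa -> frame xs aa s (set_cell s a i j c).
Proof.
move=> ax; split=> [//|b bn]; apply/funext => x; apply/funext => y /=.
by have [e|//] := eqVneq b a; rewrite e ax in bn.
Qed.

(** Induction on the number of remaining rounds. The counter is incremented after the body, so the
    invariant is required of the state with the new counter. *)
Lemma terminates_for r b body xs aa N (J : nat -> state R -> Prop) s Q :
  r \notin xs ->
  (forall s', frame (r :: xs) aa s s' -> neval s' b = N) ->
  J 0 (set_reg s r 0) ->
  (forall k s', (k < N)%N -> frame (r :: xs) aa s s' -> reg s' r = k -> J k s' ->
     terminates body s' (fun s'' => frame xs aa s' s'' /\ J k.+1 (set_reg s'' r k.+1))) ->
  (forall s', frame (r :: xs) aa s s' -> J N s' -> Q s') ->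
  terminates (CFor r b body) s Q.
Proof.
move=> rxs bN J0 Jstep JQ; apply: terminates_seq.
eexists; first exact: EReg.
have F0 k : frame (r :: xs) aa s (set_reg s r k) by apply: frame_reg; rewrite mem_head.
suff loop m k s' : (k + m)%N = N -> frame (r :: xs) aa s s' -> reg s' r = k ->
    J k s' -> terminates (CWhile (TLe (NAdd (NReg r) (NConst 1)) b)
      (CSeq body (CReg r (NAdd (NReg r) (NConst 1))))) s' Q.
  by apply: (loop N 0) => //=; rewrite eqxx.
elim: m k s' => [|m IH] k s' kN F rk Jk.
  exists s'; last by apply: JQ => //; rewrite -kN addn0.
  by apply: EWhileF; rewrite /= (bN _ F) rk -kN; lia.
have [|s1 e1 [F1 J1]] := Jstep k s' _ F rk Jk; first by lia.
have r1 : reg s1 r = k by rewrite F1.1.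
have [||||s2 e2 q] := IH k.+1 (set_reg s1 r k.+1); rewrite /= ?eqxx //; first by lia.
  apply: frame_trans F _; apply: frame_trans (frame_reg _ _ _ _); last exact: mem_head.
  apply: frame_weaken F1; last by apply/allP.
  by apply/allP => x xx; rewrite /= inE xx orbT.
exists s2 => //; apply: EWhileT e2; first by rewrite /= (bN _ F) rk -kN; lia.
apply: ESeq e1 _; have := EReg s1 r (NAdd (NReg r) (NConst 1)).
by rewrite /= r1 addn1.
Qed.

(** Each cell is written once, so [e] may read the very cell that it overwrites, still with its
    initial value. This permits accumulation in place. *)
Lemma terminates_table a o1 b1 o2 b2 e i0 m j0 p (v : nat -> nat -> R) s Q :
  (forall s', frame [:: 2; 3] [:: a] s s' ->
    [/\ neval s' o1 = i0, neval s' b1 = m, neval s' o2 = j0 & neval s' b2 = p]) ->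
  (forall s' i j, (i < m)%N -> (j < p)%N -> frame [:: 2; 3] [:: a] s s' ->
    reg s' 2 = i -> reg s' 3 = j ->
    arr s' a (i0 + i)%N (j0 + j)%N = arr s a (i0 + i)%N (j0 + j)%N ->
    seval s' e = v i j) ->
  (forall s', frame [:: 2; 3] [:: a] s s' ->
    (forall x y, arr s' a x y =
      if [&& i0 <= x, x < i0 + m, j0 <= y & y < j0 + p]%N then v (x - i0)%N (y - j0)%N
      else arr s a x y) -> Q s') ->
  terminates (CTable a o1 b1 o2 b2 e) s Q.
Proof.
move=> bnd val post.
pose J i s' := forall x y, arr s' a x y =
  if [&& i0 <= x, x < i0 + i, j0 <= y & y < j0 + p]%N then v (x - i0)%N (y - j0)%N
  else arr s a x y.
apply: (terminates_for (xs := [:: 3]) (aa := [:: a]) (N := m) (J := J)) => //.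
- by move=> s' /bnd[].
- by move=> x y /=; rewrite addn0; case: ifP => // /and4P[*]; lia.
move=> i s1 im F1 ri Ji.
pose J' j s' := forall x y, arr s' a x y =
  if [&& i0 <= x, x < i0 + i, j0 <= y & y < j0 + p]%N ||
     [&& x == i0 + i, j0 <= y & y < j0 + j]%N then v (x - i0)%N (y - j0)%N
  else arr s a x y.
apply: (terminates_for (xs := [::]) (aa := [:: a]) (N := p) (J := J')) => //.
- move=> s' F; suff /bnd[] : frame [:: 2; 3] [:: a] s s' by [].
  by apply: frame_trans F1 _; apply: frame_weaken F => //=; rewrite mem_head.
- by move=> x y /=; rewrite Ji addn0; congr (if _ then _ else _); lia.
- move=> j s2 jp F2 rj Jj; apply: terminates_cell; split.
    by apply: frame_cell; rewrite mem_head.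
  have F : frame [:: 2; 3] [:: a] s s2.
    by apply: frame_trans F1 _; apply: frame_weaken F2 => //=; rewrite mem_head.
  have ri2 : reg s2 2 = i by rewrite F2.1.
  have [e1 _ e2 _] := bnd _ F.
  rewrite /= ri2 rj e1 e2 (val s2 i j) //; last first.
    by rewrite Jj; case: ifP => // h; exfalso; move: h; lia.
  move=> x y /=; rewrite eqxx /=; case: (boolP ((x == _) && (y == _))) => h.
    by rewrite ifT; [congr v; lia | lia].
  by rewrite Jj; congr (if _ then _ else _); move: h; lia.
move=> s' F Jp; split; first by apply: frame_weaken F => //=; rewrite mem_head.
by move=> x y /=; rewrite Jp; congr (if _ then _ else _); lia.
Qed.

Lemma terminates_find b e N (f : nat -> R) s Q :
  (forall s', frame [:: 2; 4] [::] s s' -> neval s' b = N) ->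
  (forall s' i, (i < N)%N -> frame [:: 2; 4] [::] s s' -> reg s' 2 = i ->
     seval s' e = f i) ->
  (forall s', frame [:: 2; 4] [::] s s' ->
     (forall i, (i < N)%N -> f i = 0) /\ reg s' 4 = reg s 4 \/
     (reg s' 4 < N)%N /\ f (reg s' 4) != 0 -> Q s') ->
  terminates (CFind b e) s Q.
Proof.
move=> bN val post.
pose J k s' := (forall i, (i < k)%N -> f i = 0) /\ reg s' 4 = reg s 4 \/
               (reg s' 4 < N)%N /\ f (reg s' 4) != 0.
apply: (terminates_for (xs := [:: 4]) (aa := [::]) (N := N) (J := J)) => //.
- by left; split.
- move=> k s' kN F rk Jk; have vk := val _ _ kN F rk.
  apply: terminates_if => /=; rewrite vk mulr0z.
    move=> fk; eexists; first exact: EReg.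
    by split; [apply: frame_reg | right; rewrite /= rk].
  rewrite negbK => /eqP fk; exists s'; first exact: ESkip.
  split; first by split.
  case: Jk => [[f0 r4]|h]; [left|by right]; split=> // i.
  by rewrite ltnS leq_eqVlt => /orP[/eqP->|/f0].
Qed.

End TotalCorrectness.

(** * Elimination *)

(** The columns of [K] lie in the common kernel of the first [i] rows of [M], and [K] fixes that
    kernel, so it is a projection onto it. Indices are natural numbers, as in the arrays. *)
Definition kernel_projection (R : realType) (N : nat) (M : nat -> nat -> R) (i : nat)
    (K : nat -> nat -> R) : Prop :=
  (forall r l, (r < i)%N -> (l < N)%N -> \sum_(k < N) M r k * K k l = 0) /\
  (forall x : nat -> R, (forall r, (r < i)%N -> \sum_(k < N) M r k * x k = 0) ->
     forall a, (a < N)%N -> \sum_(l < N) K a l * x l = x a).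

Lemma kernel_projection_id (R : realType) N (M K : nat -> nat -> R) :
  (forall a l, (a < N)%N -> (l < N)%N -> K a l = (a == l)%:R) ->
  kernel_projection N M 0 K.
Proof.
move=> KE; split=> // x _ a aN.
rewrite (bigD1 (Ordinal aN)) //= KE // eqxx mul1r big1 ?addr0 // => l.
rewrite -val_eqE /= eq_sym => /negbTE la.
by rewrite KE ?ltn_ord // la mul0r.
Qed.

(* If K x = x and row i vanishes at x, then y x = 0, so x is also fixed by K - t y; the
   choice of t makes the product of row i and t equal to 1. *)
Lemma kernel_projection_step (R : realType) N (M K K' : nat -> nat -> R) i
    (t y : nat -> R) :
  kernel_projection N M i K ->
  (forall l, (l < N)%N -> y l = \sum_(k < N) M i k * K k l) ->
  (forall a l, (a < N)%N -> (l < N)%N -> K' a l = K a l - t a * y l) ->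
  (forall l, (l < N)%N -> y l = 0) \/
  (exists c, [/\ (c < N)%N, y c != 0 & forall a, (a < N)%N -> t a = K a c * (1 / y c)]) ->
  kernel_projection N M i.+1 K'.
Proof.
move=> [K0 Kx] yE KE piv.
have rowK r l : (l < N)%N -> \sum_(k < N) M r k * K' k l =
    \sum_(k < N) M r k * K k l - (\sum_(k < N) M r k * t k) * y l.
  move=> lN; rewrite mulr_suml -sumrB; apply: eq_bigr => k _.
  by rewrite KE ?ltn_ord // mulrBr mulrA.
split.
  move=> r l; rewrite ltnS => ri lN; rewrite rowK //.
  case: piv => [y0|[c [cN yc tE]]].
    rewrite (y0 l) // mulr0 subr0; move: ri; rewrite leq_eqVlt => /orP[/eqP->|ri].
      by rewrite -yE // y0.
    exact: K0.
  (* Row [r] times [t] is entry [c] of row [r] times [K], divided by [y c]: this is 1 for row [i]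
     and 0 for the earlier rows. *)
  have tsum : \sum_(k < N) M r k * t k = (\sum_(k < N) M r k * K k c) / y c.
    rewrite mulr_suml; apply: eq_bigr => k _.
    by rewrite tE ?ltn_ord // mul1r mulrA.
  rewrite tsum; move: ri; rewrite leq_eqVlt => /orP[/eqP->|ri].
    by rewrite -!yE // divff // mul1r subrr.
  by rewrite !K0 // !mul0r subrr.
move=> x xM a aN.
have yx : \sum_(l < N) y l * x l = 0.
  rewrite -[RHS](xM i) //.
  under eq_bigr => l _ do rewrite yE ?ltn_ord // mulr_suml.
  rewrite exchange_big /=; apply: eq_bigr => k _.
  rewrite -[X in _ = _ * X]Kx ?ltn_ord // => [|r ri]; last by apply: xM; rewrite ltnS ltnW.
  by rewrite mulr_sumr; apply: eq_bigr => l _; rewrite mulrA.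
under eq_bigr => l _ do rewrite KE ?ltn_ord // mulrBl -mulrA.
rewrite sumrB -mulr_sumr yx mulr0 subr0 Kx // => r ri.
by apply: xM; rewrite ltnS ltnW.
Qed.

(** * The program *)

Definition double_size : nexp := NAdd (NReg 0) (NReg 0).

(* Register 1 contains i, array 5 the system M and array 6 the projection K.  The vectors
   y and t of [kernel_projection_step] are row 0 of array 7 and column 0 of array 8; the
   inverse of the pivot is in array 9.  Without a pivot y = 0, and t is irrelevant. *)
Definition eliminate_row : cmd :=
  CSeq (CTable 7 (NConst 0) (NConst 1) (NConst 0) double_size (SConst 0))
 (CSeq (CFor 5 double_size
         (CTable 7 (NConst 0) (NConst 1) (NConst 0) double_size
           (SAdd (SCell 7 (NConst 0) (NReg 3))
                 (SMul (SCell 5 (NReg 1) (NReg 5)) (SCell 6 (NReg 5) (NReg 3))))))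
 (CSeq (CFind double_size (SCell 7 (NConst 0) (NReg 2)))
 (CSeq (CIf (TNot (TEq (SCell 7 (NConst 0) (NReg 4)) (SConst 0)))
         (CDiv 9 (NConst 0) (NConst 0) (SConst 1) (SCell 7 (NConst 0) (NReg 4)))
         CSkip)
 (CSeq (CTable 8 (NConst 0) double_size (NConst 0) (NConst 1)
         (SMul (SCell 6 (NReg 2) (NReg 4)) (SCell 9 (NConst 0) (NConst 0))))
       (CTable 6 (NConst 0) double_size (NConst 0) double_size
         (SSub (SCell 6 (NReg 2) (NReg 3))
               (SMul (SCell 8 (NReg 2) (NConst 0)) (SCell 7 (NConst 0) (NReg 3))))))))).

Lemma eliminate_row_correct (R : realType) (s : state R) n i :
  reg s 0 = n -> reg s 1 = i ->
  kernel_projection (n + n) (arr s 5) i (arr s 6) ->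
  terminates eliminate_row s (fun s' => frame [:: 2; 3; 4; 5] [:: 6; 7; 8; 9] s s' /\
    kernel_projection (n + n) (arr s' 5) i.+1 (arr s' 6)).
Proof.
move=> r0 r1 KP; set N := (n + n)%N.
pose y l := \sum_(k < N) arr s 5 i k * arr s 6 k l.
apply: terminates_seq; apply: (terminates_table (i0 := 0) (m := 1) (j0 := 0) (p := N)
  (v := fun _ _ => 0)) => //.
  by move=> s' F; split=> //=; rewrite F.1 // r0.
move=> s1 F1 y1.
apply: terminates_seq.
apply: (terminates_for (xs := [:: 2; 3]) (aa := [:: 7]) (N := N)
  (J := fun m s' => forall l, (l < N)%N ->
     arr s' 7 0 l = \sum_(k < m) arr s 5 i k * arr s 6 k l)) => //.
- by move=> s' F; rewrite /= F.1 // F1.1 // r0.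
- by move=> l lN /=; rewrite y1 /= lN big_ord0.
- move=> k s' kN F rk Jk.
  apply: (terminates_table (i0 := 0) (m := 1) (j0 := 0) (p := N)
    (v := fun _ l => arr s' 7 0 l + arr s 5 i k * arr s 6 k l)) => //.
  + by move=> s2 F2; split=> //=; rewrite F2.1 // F.1 // F1.1 // r0.
  + move=> s2 x l; rewrite ltnS leqn0 => /eqP-> lN F2 _ rl; rewrite !add0n => e.
    rewrite /= rl e (F2.1 1) // (F2.1 5) // (F.1 1) // (F1.1 1) // r1 rk.
    by rewrite !(F2.2 5, F2.2 6, F.2 5, F.2 6, F1.2 5, F1.2 6).
  + move=> s2 F2 e; split=> // l lN /=.
    by rewrite e /= lN subn0 big_ord_recr /= Jk.
move=> s2 F2 y2.
apply: terminates_seq.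
apply: (terminates_find (N := N) (f := y)).
- by move=> s' F; rewrite /= F.1 // F2.1 // F1.1 // r0.
- by move=> s' l lN F rl; rewrite /= rl F.2 // y2.
move=> s3 F3 piv.
apply: terminates_seq.
have {F1 F2 F3} F3 : frame [:: 2; 3; 4; 5] [:: 6; 7; 8; 9] s s3 /\
    [/\ arr s3 5 = arr s 5, arr s3 6 = arr s 6 & arr s3 7 = arr s2 7].
  split; last by split; rewrite F3.2 // F2.2 // F1.2.
  apply: frame_trans (frame_weaken _ _ F3) => //.
  by apply: frame_trans (frame_weaken _ _ F1) (frame_weaken _ _ F2).
have [{}F3 [e35 e36 e37]] := F3.
(* This covers both branches of the test. Array 7 is known to agree with [y] only below [N], whence
   the bound on register 4, which may hold an old index if there is no pivot. *)
suff div s4 : frame [::] [:: 9] s3 s4 ->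
    (y (reg s3 4) != 0 -> (reg s3 4 < N)%N -> arr s4 9 0 0 = 1 / y (reg s3 4)) ->
    terminates (CSeq (CTable 8 (NConst 0) double_size (NConst 0) (NConst 1)
         (SMul (SCell 6 (NReg 2) (NReg 4)) (SCell 9 (NConst 0) (NConst 0))))
       (CTable 6 (NConst 0) double_size (NConst 0) double_size
         (SSub (SCell 6 (NReg 2) (NReg 3))
               (SMul (SCell 8 (NReg 2) (NConst 0)) (SCell 7 (NConst 0) (NReg 3)))))) s4
     (fun s' => frame [:: 2; 3; 4; 5] [:: 6; 7; 8; 9] s s' /\
      kernel_projection (n + n) (arr s' 5) i.+1 (arr s' 6)).
  apply: terminates_if => /=; rewrite mulr0z => hd.
    eexists; first by apply: EDiv.
    apply: div => [|_ cN]; first by apply: frame_cell.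
    by rewrite /= e37 y2.
  exists s3; first exact: ESkip.
  apply: div => // yc cN; move: hd; rewrite negbK e37 y2 // => /eqP yc0.
  by rewrite -/(y _) in yc0; rewrite yc0 eqxx in yc.
move=> F4 inv.
apply: terminates_seq.
apply: (terminates_table (i0 := 0) (m := N) (j0 := 0) (p := 1)
  (v := fun a _ => arr s 6 a (reg s3 4) * arr s4 9 0 0)) => //.
- by move=> s' F; split=> //=; rewrite F.1 // F4.1 // F3.1 // r0.
- move=> s' a l aN _ F ra _ _.
  by rewrite /= ra (F.1 4) // F4.1 // F.2 // F4.2 // e36 F.2.
move=> s5 F5 t5.
apply: (terminates_table (i0 := 0) (m := N) (j0 := 0) (p := N)
  (v := fun a l => arr s 6 a l - arr s5 8 a 0 * y l)) => //.
- by move=> s' F; split=> //=; rewrite F.1 // F5.1 // F4.1 // F3.1 // r0.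
- move=> s' a l aN lN F ra rl; rewrite !add0n => e.
  rewrite /= ra rl e (F.2 8) // (F.2 7) // (F5.2 7) // (F4.2 7) // e37 y2 //.
  by rewrite F5.2 // F4.2 // e36 mulN1r.
move=> s6 F6 K6; split.
  apply: frame_trans (frame_weaken _ _ F6) => //.
  apply: frame_trans (frame_weaken _ _ F5) => //.
  by apply: frame_trans (frame_weaken _ _ F4).
have -> : arr s6 5 = arr s 5 by rewrite F6.2 // F5.2 // F4.2.
apply: (kernel_projection_step (t := fun a => arr s5 8 a 0) (y := y) KP) => //.
  by move=> a l aN lN; rewrite K6 /= aN lN !subn0.
case: piv => [[y0 _]|[cN yc]]; [by left | right; exists (reg s3 4); split=> // a aN].
by rewrite t5 /= aN subn0 inv.
Qed.

(** Array 6 becomes the identity, which starts the elimination and also supplies the entries of [E].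
    The upper right block of array 5 keeps its initial zeros. *)
Definition build_system : cmd :=
  let id := SCell 6 (NReg 2) (NReg 3) in
  let B0 := SCell 0 (NReg 2) (NReg 3) in
  let B1 := SCell 1 (NReg 2) (NReg 3) in
  CSeq (CFor 1 double_size (CCell 6 (NReg 1) (NReg 1) (SConst 1)))
 (CSeq (CTable 5 (NConst 0) (NReg 0) (NConst 0) (NReg 0) (SSub (SSub id B0) B1))
 (CSeq (CTable 5 (NReg 0) (NReg 0) (NConst 0) (NReg 0) (SSub B1 id))
       (CTable 5 (NReg 0) (NReg 0) (NReg 0) (NReg 0) (SSub (SSub (SAdd id id) B0) B1)))).

(** A zero row leaves register 4 alone, so the register ends at the column of the last nonzero entry
    met. *)
Definition find_nonzero_column : cmd :=
  CFor 1 double_size (CFind double_size (SCell 6 (NReg 1) (NReg 2))).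

(** The selected column is [u] above [f]. Array 2 keeps its initial zeros, so [b0 = 0]; array 3
    receives [u], from which [B1 u] is subtracted one summand at a time. *)
Definition write_solution : cmd :=
  CSeq (CTable 4 (NConst 0) (NReg 0) (NConst 0) (NConst 1)
         (SCell 6 (NAdd (NReg 0) (NReg 2)) (NReg 4)))
 (CSeq (CCell 4 (NReg 0) (NConst 0) (SConst 1))
 (CSeq (CTable 3 (NConst 0) (NReg 0) (NConst 0) (NConst 1) (SCell 6 (NReg 2) (NReg 4)))
       (CFor 5 (NReg 0)
         (CTable 3 (NConst 0) (NReg 0) (NConst 0) (NConst 1)
           (SSub (SCell 3 (NReg 2) (NConst 0))
                 (SMul (SCell 1 (NReg 2) (NReg 5)) (SCell 6 (NReg 5) (NReg 4)))))))).

Definition solve : cmd :=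
  CSeq build_system
 (CSeq (CFor 1 double_size eliminate_row)
 (CSeq find_nonzero_column write_solution)).

(** * Correctness of the program *)

Section Solve.
Variable R : realType.
Implicit Type s : state R.

Lemma cells_ord m p (A : 'M[R]_(m, p)) (i : 'I_m) (j : 'I_p) : cells A i j = A i j.
Proof. by rewrite /cells !valK. Qed.

Lemma build_system_correct n (B0 B1 : 'M[R]_n) :
  terminates build_system (input_state B0 B1) (fun s =>
    [/\ frame [:: 1; 2; 3] [:: 5; 6] (input_state B0 B1) s,
        forall i j : 'I_(n + n), arr s 5 i j = kernel_system B0 B1 i j &
        forall a l, (a < n + n)%N -> (l < n + n)%N -> arr s 6 a l = (a == l)%:R]).
Proof.
set s := input_state B0 B1; set N := (n + n)%N.
apply: terminates_seq.
apply: (terminates_for (xs := [::]) (aa := [:: 6]) (N := N) (J := fun k s' =>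
  forall a l, arr s' 6 a l = ((a == l) && (a < k)%N)%:R)) => //.
- by move=> s' F; rewrite /= F.1.
- by move=> a l /=; rewrite andbF.
- move=> k s' _ F rk Jk; apply: terminates_cell; split; first exact: frame_cell.
  move=> a l /=; rewrite rk Jk; case: ifP => [/andP[/eqP-> /eqP->]|h].
    by rewrite eqxx ltnSn.
  by congr (nat_of_bool _)%:R; lia.
move=> s1 F1 id1.
have idE a l : (a < n)%N -> (l < n)%N -> arr s1 6 a l = (a == l)%:R.
  by move=> an ln; rewrite id1 (leq_trans an) ?leq_addr ?andbT.
apply: terminates_seq; apply: (terminates_table (i0 := 0) (m := n) (j0 := 0) (p := n)
  (v := fun i j => (i == j)%:R - cells B0 i j - cells B1 i j)) => //.
- by move=> s' F; split=> //=; rewrite F.1 // F1.1.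
- move=> s' i j im jp F ri rj _.
  by rewrite /= ri rj !F.2 // idE // (F1.2 0) // (F1.2 1) // !mulN1r.
move=> s2 F2 M2.
apply: terminates_seq; apply: (terminates_table (i0 := n) (m := n) (j0 := 0) (p := n)
  (v := fun i j => cells B1 i j - (i == j)%:R)) => //.
- by move=> s' F; split=> //=; rewrite F.1 // F2.1 // F1.1.
- move=> s' i j im jp F ri rj _.
  by rewrite /= ri rj !F.2 // !F2.2 // idE // (F1.2 1) // !mulN1r.
move=> s3 F3 M3.
apply: (terminates_table (i0 := n) (m := n) (j0 := n) (p := n)
  (v := fun i j => (i == j)%:R + (i == j)%:R - cells B0 i j - cells B1 i j)) => //.
- by move=> s' F; split=> //=; rewrite F.1 // F3.1 // F2.1 // F1.1.
- move=> s' i j im jp F ri rj _.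
  by rewrite /= ri rj !F.2 // !F3.2 // !F2.2 // idE // (F1.2 0) // (F1.2 1) // !mulN1r.
move=> s4 F4 M4; split.
- apply: frame_trans (frame_weaken _ _ F4) => //.
  apply: frame_trans (frame_weaken _ _ F3) => //.
  by apply: frame_trans (frame_weaken _ _ F1) (frame_weaken _ _ F2).
- have ordn (i : 'I_n) : (i < n)%N = true by exact: ltn_ord.
  have geq (i : 'I_n) : (n <= i)%N = false by rewrite leqNgt ltn_ord.
  move=> i j; rewrite M4 M3 M2.
  case: (split_ordP i) => i' ->; case: (split_ordP j) => j' ->.
  + rewrite /kernel_system block_mxEul /= !geq /= !subn0 !cells_ord.
    by rewrite !mxE.
  + rewrite /kernel_system block_mxEur /= !geq /= mxE.
    by rewrite (F1.2 5).
  + rewrite /kernel_system block_mxEdl /= !geq ?leq_addr ?ltn_add2l ?ordn /=.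
    by rewrite addKn subn0 !cells_ord !mxE.
  + rewrite /kernel_system block_mxEdr /= ?leq_addr ?ltn_add2l ?ordn /=.
    by rewrite !addKn !cells_ord !mxE -mulr2n -mulrnA mulnC mulrnA.
- by move=> a l aN lN; rewrite F4.2 // F3.2 // F2.2 // id1 aN andbT.
Qed.

(** Once row [a] has been scanned, register 4 is the column of a nonzero entry, and later rows can
    replace it only by another such column. *)
Lemma find_nonzero_column_correct s n :
  reg s 0 = n ->
  (exists a l, [/\ (a < n + n)%N, (l < n + n)%N & arr s 6 a l != 0]) ->
  terminates find_nonzero_column s (fun s' => frame [:: 1; 2; 4] [::] s s' /\
    (reg s' 4 < n + n)%N /\ exists2 a, (a < n + n)%N & arr s 6 a (reg s' 4) != 0).
Proof.
move=> r0 [a [l [aN lN nz]]].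
apply: (terminates_for (xs := [:: 2; 4]) (aa := [::]) (N := (n + n)%N) (J := fun k s' =>
  (a < k)%N -> (reg s' 4 < n + n)%N /\
    exists2 a', (a' < n + n)%N & arr s 6 a' (reg s' 4) != 0)) => //.
- by move=> s' F; rewrite /= F.1 // r0.
- move=> k s' kN F rk Jk.
  apply: (terminates_find (N := (n + n)%N) (f := arr s 6 k)).
  + by move=> s2 F2; rewrite /= F2.1 // F.1 // r0.
  + by move=> s2 i _ F2 ri; rewrite /= ri F2.1 // rk F2.2 // F.2.
  move=> s2 F2 found; split=> //= ak.
  case: found => [[row0 r4]|[cN nzc]]; last by split=> //; exists k.
  rewrite r4; apply: Jk; move: ak; rewrite ltnS leq_eqVlt => /orP[/eqP e|//].
  by rewrite e row0 ?eqxx in nz.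
move=> s' F J; split; last exact: J.
by apply: frame_weaken F.
Qed.

Lemma write_solution_correct s n (B1 : 'M[R]_n) (z : 'cV[R]_(n + n)) :
  reg s 0 = n -> (forall i j : 'I_n, arr s 1 i j = B1 i j) ->
  (forall i : 'I_(n + n), arr s 6 i (reg s 4) = z i 0) ->
  terminates write_solution s (fun s' =>
    [/\ arr s' 2 = arr s 2,
        output_col n s' 3 = usubmx z - B1 *m usubmx z &
        output_col (n + 1) s' 4 = col_mx (dsubmx z) 1%:M]).
Proof.
move=> r0 B1E zE.
apply: terminates_seq; apply: (terminates_table (i0 := 0) (m := n) (j0 := 0) (p := 1)
  (v := fun i _ => arr s 6 (n + i)%N (reg s 4))) => //.
- by move=> s' F; split=> //=; rewrite F.1 // r0.
- by move=> s' i j im _ F ri _ _; rewrite /= ri (F.1 0) // (F.1 4) // F.2 // r0.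
move=> s1 F1 out4.
apply: terminates_seq; apply: terminates_cell; rewrite /= F1.1 // r0.
set s2 := set_cell _ _ _ _ _.
have F2 : frame [::] [:: 4] s1 s2 by exact: frame_cell.
apply: terminates_seq; apply: (terminates_table (i0 := 0) (m := n) (j0 := 0) (p := 1)
  (v := fun i _ => arr s 6 i (reg s 4))) => //.
- by move=> s' F; split=> //=; rewrite F.1 // F2.1 // F1.1 // r0.
- move=> s' i j im _ F ri _ _; rewrite /= ri (F.1 4) // F2.1 // F1.1 //.
  by rewrite F.2 // F2.2 // F1.2.
move=> s3 F3 out3.
have r03 : reg s3 0 = n by rewrite F3.1 // F2.1 // F1.1.
have r43 : reg s3 4 = reg s 4 by rewrite F3.1 // F2.1 // F1.1.
have [e1 e2 e6 e4] : [/\ arr s3 1 = arr s 1, arr s3 2 = arr s 2, arr s3 6 = arr s 6 &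
    arr s3 4 = arr s2 4].
  by split; rewrite F3.2 // ?F2.2 // F1.2.
apply: (terminates_for (xs := [:: 2; 3]) (aa := [:: 3]) (N := n) (J := fun m s' =>
  forall i, (i < n)%N -> arr s' 3 i 0 =
    arr s 6 i (reg s 4) - \sum_(k < m) arr s 1 i k * arr s 6 k (reg s 4))) => //.
- by move=> s' F; rewrite /= F.1.
- by move=> i im; rewrite /= out3 /= im subn0 big_ord0 subr0.
- move=> k s' kn F rk Jk.
  apply: (terminates_table (i0 := 0) (m := n) (j0 := 0) (p := 1)
    (v := fun i _ => arr s' 3 i 0 - arr s 1 i k * arr s 6 k (reg s 4))) => //.
  + by move=> s4 F4; split=> //=; rewrite F4.1 // F.1.
  + move=> s4 i j im; rewrite ltnS leqn0 => /eqP-> F4 ri _; rewrite !add0n => e.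
    rewrite /= ri e (F4.1 5) // rk (F4.1 4) // (F.1 4) // r43.
    by rewrite (F4.2 1) // (F4.2 6) // (F.2 1) // (F.2 6) // e1 e6 mulN1r.
  + move=> s4 F4 e; split=> // i im /=.
    by rewrite e /= im subn0 big_ord_recr /= Jk // opprD addrA.
move=> s4 F4 J4; split; first by rewrite F4.2.
  apply/matrixP => i j; rewrite !mxE (ord1 j) J4 // -zE; congr (_ - _).
  by apply: eq_bigr => k _; rewrite B1E !mxE -zE.
apply/matrixP => i j; rewrite (ord1 j) !mxE F4.2 // e4 /s2 /=.
case: (split_ordP i) => i' ->; rewrite ?col_mxEu ?col_mxEd /=.
  by rewrite ltn_eqF ?ltn_ord //= out4 /= ltn_ord subn0 !mxE -zE.
by rewrite (ord1 i') /= addn0 eqxx !mxE.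
Qed.

Lemma solve_correct n (B0 B1 : 'M[R]_n) :
  stable B0 B1 -> \det (B0 + B1 - 1%:M) = 0 -> finds_solution solve B0 B1.
Proof.
move=> stab detG; set N := (n + n)%N.
suff [s e] : terminates solve (input_state B0 B1) (fun s =>
    exists z : 'cV[R]_(n + n), [/\ kernel_system B0 B1 *m z = 0, z != 0 &
    [/\ output_col n s 2 = 0, output_col n s 3 = usubmx z - B1 *m usubmx z &
        output_col (n + 1) s 4 = col_mx (dsubmx z) 1%:M]]).
  move=> [z [Mz z0 [e2 e3 e4]]]; exists s => //.
  by rewrite e2 e3 e4; exact: kernel_system_solution.
apply: terminates_seq.
have [s1 x1 [F1 M1 K1]] := build_system_correct B0 B1; exists s1 => //.
apply: terminates_seq.
apply: (terminates_for (xs := [:: 2; 3; 4; 5]) (aa := [:: 6; 7; 8; 9]) (N := N)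
  (J := fun k s' => kernel_projection N (arr s' 5) k (arr s' 6))) => //.
- by move=> s' F; rewrite /= F.1 // F1.1.
- exact: kernel_projection_id.
- move=> k s' kN F rk Jk; apply: eliminate_row_correct => //.
  by rewrite F.1 // F1.1.
move=> s2 F2 [KM KP].
have r02 : reg s2 0 = n by rewrite F2.1 // F1.1.
have M2 (i j : 'I_N) : arr s2 5 i j = kernel_system B0 B1 i j by rewrite F2.2.
apply: terminates_seq.
have [||s3 x3 [F3 [cN [a aN nz]]]] := @find_nonzero_column_correct s2 n; first by [].
  (* The projection is nonzero, because it fixes a nonzero kernel vector [x] of the singular
     system. *)
  have [x x0 Mx] := det0_colP (det_kernel_system detG).
  have [a xa] : exists a, x a 0 != 0.
    apply: contrapT => x_eq0; move/eqP: x0; apply; apply/matrixP => i j.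
    rewrite mxE (ord1 j); apply: contrapT => /eqP xi; apply: x_eq0; by exists i.
  pose x' k := if insub k is Some i then x (i : 'I_N) 0 else 0.
  have x'E (k : 'I_N) : x' k = x k 0 by rewrite /x' valK.
  have proj : \sum_(l < N) arr s2 6 a l * x' l = x' a.
    apply: KP => // r rN; rewrite -[RHS](_ : (kernel_system B0 B1 *m x) (Ordinal rN) 0 = 0).
      by rewrite mxE; apply: eq_bigr => k _; rewrite x'E -M2.
    by rewrite Mx mxE.
  apply: contrapT => K0; move/eqP: xa; apply; rewrite -x'E -proj big1 // => l _.
  have [->|Kl] := eqVneq (arr s2 6 a l) 0; first by rewrite mul0r.
  by exfalso; apply: K0; exists a, l; split.
exists s3 => //.
(* A column of the projection lies in the kernel, and register 4 selects a nonzero one. *)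
pose z : 'cV[R]_(n + n) := \col_i arr s2 6 i (reg s3 4).
have [|||s4 x4 [e2 e3 e4]] := @write_solution_correct s3 n B1 z.
- by rewrite F3.1.
- by move=> i j; rewrite F3.2 // F2.2 // F1.2 //; exact: cells_ord.
- by move=> i; rewrite F3.2 // mxE.
exists s4 => //; exists z; split; last split=> //.
- apply/matrixP => i j; rewrite [RHS]mxE mxE (ord1 j).
  rewrite -[RHS](KM i (reg s3 4)) //.
  by apply: eq_bigr => k _; rewrite -M2 !mxE.
- apply: contraNneq nz => z0; have := congr1 (fun M : 'cV[R]_N => M (Ordinal aN) 0) z0.
  by rewrite !mxE => ->.
- apply/matrixP => i j; rewrite !mxE e2.
  by rewrite F3.2 // F2.2 // F1.2.
Qed.

End Solve.

Theorem theorem65 (R : realType) :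
  (exists P : cmd, forall (n : nat) (B0 B1 : 'M[R]_n),
     stable B0 B1 -> \det (B0 + B1 - 1%:M) = 0 ->
     finds_solution P B0 B1) /\
  (forall (n : nat) (B0 B1 : 'M[R]_n),
     stable B0 B1 -> \det (B0 + B1 - 1%:M) <> 0 ->
     (~ exists (b0 b1 : 'cV[R]_n) (F : 'cV[R]_(n + 1)),
          solution B0 B1 b0 b1 F) /\
     (forall (b0 b1 : 'cV[R]_n) (F : 'cV[R]_(n + 1)),
        requirements B0 B1 b0 b1 F ->
        forall I : 'rV[R]_(n + 1),
          omega_constant (ext_wfa B0 B1 b0 b1 F I))).
Proof.
split; first by exists solve => n B0 B1; exact: solve_correct.
move=> n B0 B1 stab detG; split.
  move=> [b0 [b1 [F [req A0F]]]]; apply: A0F.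
  exact: (requirements_fixed stab detG req false).
by move=> b0 b1 F req I; exact/fixed_omega_constant/requirements_fixed.
Qed.
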